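(* Let $G\subseteq GL(V)$ be a finite complex reflection group such that $l(g)=\operatorname{codim}V^g$ for all $g\in G$. Then $\mathrm{HH}^\bullet(S(V),S(V)\#G)$ is generated as an algebra under cup product by its elements of cohomological degrees $0$ and $1$.
   Context: $V$ is a finite-dimensional complex vector space. A reflection is a non-identity element of $GL(V)$ fixing a hyperplane pointwise; a (finite) reflection group is a finite subgroup of $GL(V)$ generated by reflections. For $g\in G$, $V^g$ is the fixed space of $g$, and the reflection length $l(g)$ is the minimal $k$ such that $g$ is a product of $k$ reflections belonging to $G$ ($l(1)=0$). $S(V)\#G$ is the skew group algebra ($S(V)\otimes\mathbb CG$ with $(a\otimes g)(b\otimes h)=a\,{}^gb\otimes gh$), and $\mathrm{HH}^\bullet(S(V),S(V)\#G)=\operatorname{Ext}^\bullet_{S(V)\otimes S(V)^{op}}(S(V),S(V)\#G)$ is the Hochschild cohomology with the cup product. *)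

(* Defs.v *)
From mathcomp Require Import all_boot all_algebra.
From mathcomp Require Import Rstruct.
From mathcomp.real_closed Require Import complex.
From mathcomp Require Import mpoly.
Set Implicit Arguments.
Unset Strict Implicit.
Unset Printing Implicit Defensive.
Import GRing.Theory.
Local Open Scope ring_scope.

Definition CC : numClosedFieldType := complex Rdefinitions.R.

(** V = C^n (column vectors), G acts on V by g . v = g *m v.
    S(V) = polynomial ring {mpoly CC[n]}, the variable 'X_j being the
    j-th basis vector e_j of V. *)
Definition SV (n : nat) := {mpoly CC[n]}.
Definition mat (n : nat) := 'M[CC]_n.

Definition fixed_space n (g : mat n) := kermx (g^T - 1%:M).
Definition codim_fixed n (g : mat n) : nat := (n - \rank (fixed_space g))%N.

Definition is_reflection n (g : mat n) : Prop :=
  g \in unitmx /\ g != 1%:M /\ \rank (fixed_space g) = n.-1.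

Definition prod_refl n (G : seq (mat n)) (g : mat n) (k : nat) : Prop :=
  exists s : seq (mat n), [/\ size s = k,
     (forall r, r \in s -> r \in G /\ is_reflection r)
   & g = foldr (fun r acc => r *m acc) 1%:M s].

Definition refl_length n (G : seq (mat n)) (g : mat n) (k : nat) : Prop :=
  prod_refl G g k /\ forall j, prod_refl G g j -> (k <= j)%N.

Definition finite_reflection_group n (G : seq (mat n)) : Prop :=
  [/\ uniq G, 1%:M \in G,
      (forall g, g \in G -> g \in unitmx),
      (forall g h, g \in G -> h \in G -> g *m h \in G)
    & (forall g, g \in G -> exists k, prod_refl G g k)].

(** Action of g on S(V): the algebra automorphism extending
    e_j |-> g e_j = \sum_i g i j e_i. *)
Definition act n (g : mat n) (p : SV n) : SV n :=
  p \mPo [tuple \sum_(i < n) g i j *: 'X_i | j < n].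

(** Skew group algebra S(V)#G: an element \sum_g a_g # g is represented by
    the function g |-> a_g (required to vanish off G, see [supported]). *)
Definition skew n := mat n -> SV n.

Definition skew_mul n (G : seq (mat n)) (x y : skew n) : skew n :=
  fun k => \sum_(g <- G) \sum_(h <- G | g *m h == k) x g * act g (y h).

Definition embed n (a : SV n) : skew n := fun k => if k == 1%:M then a else 0.

(** Hochschild cochains C^p(S(V), S(V)#G) = Hom_C(S(V)^{(x)p}, S(V)#G),
    i.e. C-multilinear maps S(V)^p -> S(V)#G (bar complex). *)
Definition cochain n (p : nat) := ('I_p -> SV n) -> skew n.

Definition upd n p (a : 'I_p -> SV n) (i : 'I_p) (u : SV n) : 'I_p -> SV n :=
  fun j => if j == i then u else a j.

Definition multilinear n p (f : cochain n p) : Prop :=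
  forall (a : 'I_p -> SV n) (i : 'I_p) (c : CC) (u v : SV n) (k : mat n),
    f (upd a i (c *: u + v)) k = c *: f (upd a i u) k + f (upd a i v) k.

Definition supported n (G : seq (mat n)) p (f : cochain n p) : Prop :=
  forall a k, k \notin G -> f a k = 0.

Definition merge n p (a : 'I_p.+1 -> SV n) (i : 'I_p) : 'I_p -> SV n :=
  fun j => if (j < i)%N then a (widen_ord (leqnSn p) j)
           else if j == i then a (widen_ord (leqnSn p) j) * a (lift ord0 j)
           else a (lift ord0 j).

Definition hdiff n (G : seq (mat n)) p (f : cochain n p) : cochain n p.+1 :=
  fun a k =>
    skew_mul G (embed (a ord0)) (f (fun i => a (lift ord0 i))) k
    + \sum_(i < p) (-1) ^+ i.+1 *: f (merge a i) k
    + (-1) ^+ p.+1 *: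
        skew_mul G (f (fun i => a (widen_ord (leqnSn p) i))) (embed (a ord_max)) k.

Definition cocycle n (G : seq (mat n)) p (f : cochain n p) : Prop :=
  [/\ multilinear f, supported G f & forall a k, hdiff G f a k = 0].

Definition coboundary n (G : seq (mat n)) : forall p, cochain n p -> Prop :=
  fun p => match p return cochain n p -> Prop with
  | 0 => fun f => forall a k, f a k = 0
  | p'.+1 => fun f => exists h : cochain n p',
      [/\ multilinear h, supported G h & forall a k, f a k = hdiff G h a k]
  end.

Definition cup n (G : seq (mat n)) p q (f : cochain n p) (g : cochain n q)
  : cochain n (p + q) :=
  fun a => skew_mul G (f (fun i => a (lshift q i))) (g (fun j => a (rshift p j))).

Inductive gen01 n (G : seq (mat n)) : forall p, cochain n p -> Prop :=
  | gen01_deg0 f : cocycle G f -> @gen01 n G 0 f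
  | gen01_deg1 f : cocycle G f -> @gen01 n G 1 f
  | gen01_cup p q f g : @gen01 n G p f -> @gen01 n G q g ->
      @gen01 n G (p + q) (cup G f g)
  | gen01_add p f g : @gen01 n G p f -> @gen01 n G p g ->
      @gen01 n G p (fun a k => f a k + g a k)
  | gen01_scale p (c : CC) f : @gen01 n G p f ->
      @gen01 n G p (fun a k => c *: f a k).

(* Main.v *)
Require Import Defs.
From HB Require Import structures.
From mathcomp Require Import all_boot all_algebra.
From mathcomp Require Import Rstruct.
From mathcomp Require Import boolp functions.
From mathcomp.real_closed Require Import complex.
From mathcomp Require Import mpoly.
From mathcomp Require Import ring zify.
Set Implicit Arguments.
Unset Strict Implicit.
Unset Printing Implicit Defensive.
Import GRing.Theory.
Local Open Scope ring_scope.

(** The component at [k] of a cochain with values in the skew group algebra is a Hochschild cochain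
    of [S = S(V)] with values in [S] twisted on the right by [k], and the differential respects this
    splitting ([hdiff_component]). So each [k] in [G] can be treated separately.

    Such a component is compared with a Koszul complex. Antisymmetrization on the variables
    ([kappa]) goes one way, products of divided differences ([stairmap]) go back, and both commute
    with the differentials. That a cocycle [f] differs from [stairmap 0 (kappa _ f)] by a coboundary
    is [theta_coboundary], proved by dimension shifting rather than with an explicit homotopy. In
    suitable coordinates, with d = codim V^k, the Koszul differential is given by linear forms e_0,
    ..., e_(n-1) of which the first d are independent and the others vanish. The first d form a
    regular sequence, so every Koszul cocycle is cohomologous to one supported on index sets that
    contain 0, ..., d-1 ([kosz_exact]).

    It remains to build these classes from degrees 0 and 1. The hypothesis on lengths writes k as a
    product of d reflections r_i = 1 + u_i lambda_i of G. Each r_i carries a twisted derivation with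
    value lambda_i(v) at v in V, which is a 1-cocycle in the component r_i ([twder_of_rank1]). The
    cup product of these lies in the component k and antisymmetrizes to the wedge of the lambda_i
    ([kappa_listcup]). Expanding the product of the r_i gives 1 - k = sum_i q_i lambda_i; as this
    has rank d, the lambda_i are independent and involve only the first d coordinates
    ([gauss_data]), so their wedge is a nonzero multiple of dx_0 ... dx_(d-1). Cup products with
    ordinary derivations and with polynomials in degree 0, all in the component of the identity,
    then reach every class ([wedges_dual], [cocycle_decomposition]). *)

(* Proves an identity of abelian groups in which every atom cancels after all
   terms have been moved to one side. *)
Ltac zmod :=
  apply/eqP; rewrite -subr_eq0; apply/eqP; rewrite ?(opprD, opprB, opprK, addrA);
  match goal with |- ?l = _ => rewrite -[l]add0r ?addrA end;
  repeat match goal with |- context [- ?x] =>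
    rewrite ?[_ + x + _]addrAC ?[_ - x + _]addrAC addrK
  end; by [].

(** * Bar cochains on lists and their antisymmetrization into Koszul cochains *)

Section BarComplex.
Variables (S T : comNzRingType) (M : lmodType T).
Implicit Types (f g : seq S -> M) (a b v : S) (s : seq S).

(** The Hochschild differential without its left-action term: inner merges, then the right action on
    the last entry. The alternating signs come from the nested subtractions. *)
Fixpoint bmul (wr : S -> T) f a s : M :=
  if s is b :: s' then f (a * b :: s') - bmul wr (fun u => f (a :: u)) b s'
  else wr a *: f [::].

Definition bdiff (wl wr : S -> T) f s : M :=
  if s is a :: s' then wl a *: f s' - bmul wr f a s' else 0.

Fixpoint ins v f s : M :=
  f (v :: s) - (if s is a :: s' then ins v (fun u => f (a :: u)) s' else 0).

Lemma eq_bmul_sized wr f g a s :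
  (forall u, (size u = size s) -> f u = g u) -> bmul wr f a s = bmul wr g a s.
Proof.
elim: s f g a => [|b s IHs] f g a fg /=; first by rewrite fg.
by rewrite fg //; congr (_ - _); apply: IHs => u su; rewrite fg //= su.
Qed.

Lemma eq_bmul wr f g a s : f =1 g -> bmul wr f a s = bmul wr g a s.
Proof. by move=> fg; apply: eq_bmul_sized. Qed.

Lemma eq_bdiff_sized wl wr f g s :
  (forall u, (size u).+1 = size s -> f u = g u) ->
  bdiff wl wr f s = bdiff wl wr g s.
Proof.
case: s => //= a s fg; rewrite fg //; congr (_ - _).
by apply: eq_bmul_sized => u su; rewrite fg // su.
Qed.

Lemma eq_bdiff wl wr f g s : f =1 g -> bdiff wl wr f s = bdiff wl wr g s.
Proof. by move=> fg; apply: eq_bdiff_sized. Qed.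

Lemma eq_ins v f g s : f =1 g -> ins v f s = ins v g s.
Proof.
elim: s f g => [|a s IHs] f g fg /=; rewrite fg //; congr (_ - _).
by apply: IHs => u; rewrite fg.
Qed.

Lemma bmulDZ wr (t : T) f g a s :
  bmul wr (fun u => t *: f u + g u) a s = t *: bmul wr f a s + bmul wr g a s.
Proof.
elim: s f g a => [|b s IHs] f g a /=.
  by rewrite scalerDr !scalerA mulrC.
rewrite (IHs (fun u => f (a :: u)) (fun u => g (a :: u))).
by rewrite scalerBr opprD addrACA.
Qed.

Lemma insDZ v (t : T) f g s :
  ins v (fun u => t *: f u + g u) s = t *: ins v f s + ins v g s.
Proof.
elim: s f g => [|a s IHs] f g /=; first by rewrite !subr0.
rewrite (IHs (fun u => f (a :: u)) (fun u => g (a :: u))).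
by rewrite scalerBr opprD addrACA.
Qed.

Lemma bmulB wr f g a s :
  bmul wr (fun u => f u - g u) a s = bmul wr f a s - bmul wr g a s.
Proof.
rewrite addrC -scaleN1r -bmulDZ; apply: eq_bmul => u.
by rewrite scaleN1r addrC.
Qed.

Lemma bmulZ wr (t : T) f a s :
  bmul wr (fun u => t *: f u) a s = t *: bmul wr f a s.
Proof.
elim: s f a => [|b s IHs] f a /=; first by rewrite !scalerA mulrC.
by rewrite (IHs (fun u => f (a :: u))) scalerBr.
Qed.

Lemma insB v f g s : ins v (fun u => f u - g u) s = ins v f s - ins v g s.
Proof.
rewrite addrC -scaleN1r -insDZ; apply: eq_ins => u.
by rewrite scaleN1r addrC.
Qed.

Lemma insZ v (t : T) f s : ins v (fun u => t *: f u) s = t *: ins v f s.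
Proof.
elim: s f => [|a s IHs] f /=; first by rewrite !subr0.
by rewrite (IHs (fun u => f (a :: u))) scalerBr.
Qed.

Lemma bdiffDZ wl wr (t : T) f g s :
  bdiff wl wr (fun u => t *: f u + g u) s
    = t *: bdiff wl wr f s + bdiff wl wr g s.
Proof.
case: s => [|a s] /=; first by rewrite scaler0 addr0.
by rewrite bmulDZ scalerDr scalerBr !scalerA mulrC opprD addrACA.
Qed.

Lemma bdiffB wl wr f g s :
  bdiff wl wr (fun u => f u - g u) s = bdiff wl wr f s - bdiff wl wr g s.
Proof.
rewrite addrC -scaleN1r -bdiffDZ; apply: eq_bdiff => u.
by rewrite scaleN1r addrC.
Qed.

Variables (wl wr : {rmorphism S -> T}).

(** The double merges cancel in pairs, leaving [a] and [b] only as a product. This is the content of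
    d^2 = 0. *)
Lemma bmul_bmul f a b s :
  bmul wr (bmul wr f a) b s = bmul wr f (a * b) s.
Proof.
elim: s f a b => [|c s IHs] f a b /=.
  by rewrite scalerA -rmorphM mulrC.
rewrite bmulB opprB (IHs (fun u => f (a :: u))) mulrA.
by rewrite addrA addrNK.
Qed.

Lemma bmul_bdiff f a s :
  bmul wr (bdiff wl wr f) a s = wl a *: bdiff wl wr f s.
Proof.
elim: s f a => [|b s IHs] f a /=; first by rewrite !scaler0.
rewrite bmulB bmulZ bmul_bmul rmorphM scalerBr scalerA.
by rewrite opprB addrA addrNK.
Qed.

Lemma bdiff_bdiff f s : bdiff wl wr (bdiff wl wr f) s = 0.
Proof. by case: s => //= a s; rewrite bmul_bdiff subrr. Qed.

Lemma bmul_ins v f a s :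
  bmul wr (ins v f) a s = wr v *: f (a :: s) - f (v * a :: s)
    + bmul wr (fun u => f (v :: u)) a s + ins v (bmul wr f a) s.
Proof.
elim: s f a => [|b s IHs] f a /=.
  by rewrite !subr0 (mulrC v); zmod.
rewrite bmulB (IHs (fun u => f (a :: u))) insB (mulrC v a) (mulrC v b).
by zmod.
Qed.

(** Alternating insertion is a homotopy between the left and the right multiplication by [v]. The
    merges of [v] with a neighbour [a] occur as [v * a] and [a * v] with opposite signs, and cancel
    because [S] is commutative. *)
Lemma ins_bdiff v f s :
  ins v (bdiff wl wr f) s = (wl v - wr v) *: f s - bdiff wl wr (ins v f) s.
Proof.
case: s => [|a s] /=; first by rewrite !subr0 scalerBl.
by rewrite insB insZ bmul_ins scalerBl; zmod.
Qed.

(* The value on [J] is the antisymmetrization of [f] at the elements [x j],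
   [j <- J]. *)
Fixpoint kappa (x : nat -> S) f (J : seq nat) : M :=
  if J is l :: J' then kappa x (ins (x l) f) J' else f [::].

Fixpoint kosz (e : nat -> T) (phi : seq nat -> M) (J : seq nat) : M :=
  if J is l :: J' then e l *: phi J' - kosz e (fun u => phi (l :: u)) J'
  else 0.

Lemma eq_kappa x f g J : f =1 g -> kappa x f J = kappa x g J.
Proof.
by elim: J f g => [|l J IHJ] f g fg /=; [exact: fg | apply: IHJ => u; exact: eq_ins].
Qed.

Lemma eq_kosz e (phi psi : seq nat -> M) J :
  phi =1 psi -> kosz e phi J = kosz e psi J.
Proof.
elim: J phi psi => [|l J IHJ] phi psi pp //=; rewrite pp; congr (_ - _).
by apply: IHJ => u; rewrite pp.
Qed.

Lemma kappaDZ x (t : T) f g J :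
  kappa x (fun u => t *: f u + g u) J = t *: kappa x f J + kappa x g J.
Proof.
elim: J f g => //= l J IHJ f g; rewrite -IHJ; apply: eq_kappa => u.
exact: insDZ.
Qed.

Lemma koszDZ e (t : T) (phi psi : seq nat -> M) J :
  kosz e (fun u => t *: phi u + psi u) J = t *: kosz e phi J + kosz e psi J.
Proof.
elim: J phi psi => [|l J IHJ] phi psi /=; first by rewrite scaler0 addr0.
rewrite (IHJ (fun u => phi (l :: u)) (fun u => psi (l :: u))).
by rewrite scalerDr scalerBr !scalerA mulrC opprD addrACA.
Qed.

Lemma kappaZ x (t : T) f J :
  kappa x (fun u => t *: f u) J = t *: kappa x f J.
Proof.
elim: J f => //= l J IHJ f; rewrite -IHJ; apply: eq_kappa => u.
exact: insZ.
Qed.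

Lemma kappaB x f g J :
  kappa x (fun u => f u - g u) J = kappa x f J - kappa x g J.
Proof.
rewrite addrC -scaleN1r -kappaDZ; apply: eq_kappa => u.
by rewrite scaleN1r addrC.
Qed.

Lemma koszB e (phi psi : seq nat -> M) J :
  kosz e (fun u => phi u - psi u) J = kosz e phi J - kosz e psi J.
Proof.
rewrite addrC -scaleN1r -koszDZ; apply: eq_kosz => u.
by rewrite scaleN1r addrC.
Qed.

(** Iterating [ins_bdiff] along [J] produces exactly the recursion of [kosz], so antisymmetrization
    is a cochain map. *)
Lemma kappa_bdiff x f J :
  kappa x (bdiff wl wr f) J
    = kosz (fun l => wl (x l) - wr (x l)) (kappa x f) J.
Proof.
elim: J f => //= l J IHJ f; rewrite (eq_kappa _ _ (ins_bdiff _ _)).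
by rewrite kappaB kappaZ IHJ.
Qed.

Fixpoint mlin (K : Type) (sc : K -> S -> S) (sm : K -> M -> M) p f : Prop :=
  if p is q.+1 then
    (forall s, size s = q -> forall c a b,
       f (sc c a + b :: s) = sm c (f (a :: s)) + f (b :: s))
    /\ forall a, mlin sc sm q (fun s => f (a :: s))
  else True.

End BarComplex.

(** * Multilinearity of bar cochains *)

Section Multilinear.
Variables (K : comNzRingType) (S : comAlgType K) (T : comNzRingType).
Variables (M : lmodType T) (eta : K -> T) (wl wr : {rmorphism S -> T}).
Hypothesis wlZ : forall c a, wl (c *: a) = eta c * wl a.
Hypothesis wrZ : forall c a, wr (c *: a) = eta c * wr a.
Implicit Types (f g : seq S -> M) (a b v : S) (s : seq S).

Definition multilin p f : Prop :=
  mlin (fun c a => c *: a) (fun c (m : M) => eta c *: m) p f.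

Lemma eq_multilin p f g :
  (forall s, size s = p -> f s = g s) -> multilin p f -> multilin p g.
Proof.
elim: p f g => //= p IHp f g fg [f1 f2]; split=> [s sz c a b | a].
  by rewrite -!fg /= ?sz // f1.
by apply: IHp (f2 a) => s sz; rewrite fg //= sz.
Qed.

Lemma multilinDZ p (t : T) f g :
  multilin p f -> multilin p g -> multilin p (fun s => t *: f s + g s).
Proof.
elim: p f g => //= p IHp f g [f1 f2] [g1 g2]; split=> [s sz c a b | a].
  rewrite f1 // g1 // !scalerDr !scalerA (mulrC t) -!addrA; congr (_ + _).
  by rewrite addrCA.
by apply: (IHp (fun s => f (a :: s)) (fun s => g (a :: s))); [exact: f2 | exact: g2].
Qed.

Lemma multilin0 p : multilin p (fun _ => 0).
Proof.
by elim: p => //= p IHp; split=> // s _ c a b; rewrite scaler0 addr0.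
Qed.

Lemma multilinZ p (t : T) f : multilin p f -> multilin p (fun s => t *: f s).
Proof.
move=> fp; apply: eq_multilin (multilinDZ t fp (multilin0 p)) => s _.
by rewrite addr0.
Qed.

Lemma multilinB p f g :
  multilin p f -> multilin p g -> multilin p (fun s => f s - g s).
Proof.
move=> fp gp; apply: eq_multilin (multilinDZ (-1) gp fp) => s _.
by rewrite scaleN1r addrC.
Qed.

Lemma multilin_bmul p f : multilin p f ->
  multilin p.+1 (fun s => if s is a :: u then bmul wr f a u else 0).
Proof.
elim: p f => [|p IHp] f /=.
  move=> _; split=> // -[] //= _ c a b.
  by rewrite rmorphD wrZ scalerDl scalerA.
case=> f1 f2; split=> [[|x s] //= [sz] c a b | a].
  rewrite mulrDl -scalerAl f1 //.
  have -> : bmul wr (fun u => f (c *: a + b :: u)) x s =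
    eta c *: bmul wr (fun u => f (a :: u)) x s
      + bmul wr (fun u => f (b :: u)) x s.
    rewrite -bmulDZ; apply: eq_bmul_sized => u su.
    by rewrite f1 // su.
  by rewrite scalerBr opprD addrACA.
rewrite -[mlin _ _ _ _]/(multilin p.+1 _).
apply: (@eq_multilin _ (fun s => (if s is b :: u then f (a * b :: u) else 0)
   - (if s is b :: u then bmul wr (fun u => f (a :: u)) b u else 0))).
  by case=> // sz; rewrite subr0.
apply: multilinB; last by apply: IHp; exact: f2.
split=> [s sz c b b' | b]; last exact: f2.
by rewrite mulrDr -scalerAr f1.
Qed.

Lemma multilin_bdiff p f : multilin p f -> multilin p.+1 (bdiff wl wr f).
Proof.
move=> fp; apply: (@eq_multilin _ (fun s =>
   (if s is a :: u then wl a *: f u else 0)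
   - (if s is a :: u then bmul wr f a u else 0))).
  by case=> [|a s] //=; rewrite subr0.
apply: multilinB; last exact: multilin_bmul.
split=> [s sz c a b | a]; last exact: multilinZ.
by rewrite rmorphD wlZ scalerDl scalerA.
Qed.

End Multilinear.

(** * The enveloping algebra of a polynomial ring and divided differences *)

Section PolynomialMorphisms.
Variables (n : nat) (R : nzRingType) (A : comNzRingType).

Lemma mpoly_ind_ring (P : {mpoly R[n]} -> Prop) :
  (forall c, P c%:MP) -> (forall i, P 'X_i) ->
  (forall p q, P p -> P q -> P (p + q)) ->
  (forall p q, P p -> P q -> P (p * q)) -> forall p, P p.
Proof.
move=> PC PX PD PM; elim/mpolyind => [|c m p _ _ Pp].
  by rewrite -[0]mpolyC0.
apply: PD Pp; rewrite -mul_mpolyC; apply: (PM _ _ (PC c)).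
rewrite mpolyXE_id; elim/big_ind: _ => [||i _]; first by rewrite -mpolyC1.
  exact: PM.
by elim: (m i) => [|k IHk]; rewrite ?expr0 -?mpolyC1 // exprS; apply: (PM).
Qed.

Lemma mpoly_rmorph_ext (u v : {rmorphism {mpoly R[n]} -> A}) :
  (forall c, u c%:MP = v c%:MP) -> (forall i, u 'X_i = v 'X_i) -> u =1 v.
Proof.
move=> uvC uvX; elim/mpoly_ind_ring => // p q; first by rewrite !rmorphD => -> ->.
by rewrite !rmorphM => -> ->.
Qed.

(* The difference quotient in the single variable on which [u], [v] differ. *)
Lemma mpoly_rmorph_dvd (u v : {rmorphism {mpoly R[n]} -> A}) (j : 'I_n) p :
  (forall c, u c%:MP = v c%:MP) ->
  (forall i, i != j -> u 'X_i = v 'X_i) ->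
  exists q, u p - v p = (u 'X_j - v 'X_j) * q.
Proof.
move=> uvC uvX; elim/mpoly_ind_ring: p => [c | i | p p' [q E] [q' E'] | p p' [q E] [q' E']].
- by exists 0; rewrite uvC subrr mulr0.
- case: (eqVneq i j) => [-> | ne]; first by exists 1; rewrite mulr1.
  by exists 0; rewrite uvX // subrr mulr0.
- by exists (q + q'); rewrite !rmorphD mulrDr -E -E'; ring.
- exists (u p * q' + q * v p'); rewrite !rmorphM mulrDr mulrCA -E' mulrA -E.
  by ring.
Qed.

End PolynomialMorphisms.

Lemma mpoly_mul_eq0 (n : nat) (R : idomainType) (p q : {mpoly R[n]}) :
  p * q = 0 -> p = 0 \/ q = 0.
Proof. by move/eqP; rewrite mulf_eq0 => /orP[] /eqP; [left | right]. Qed.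

(* The [l]-th variable, and [0] when [n <= l]. *)
Definition xvar (n : nat) (R : nzRingType) (l : nat) : {mpoly R[n]} :=
  oapp (fun i : 'I_n => 'X_i) 0 (insub l).

(* The enveloping algebra of the polynomial ring: its variables act from the
   left and its coefficients from the right. *)
Definition envel (F : fieldType) (n : nat) : Type := {mpoly {mpoly F[n]}[n]}.
HB.instance Definition _ F n := GRing.ComNzRing.on (envel F n).

Section Envelope.
Variables (F : fieldType) (n : nat).

Definition rightT (a : {mpoly F[n]}) : envel F n := a%:MP.
Definition leftX (i : 'I_n) : envel F n := 'X_i.

Fact rightT_additive : additive rightT.
Proof. by move=> x y; exact: mpolyCB. Qed.

Fact rightT_multiplicative : multiplicative rightT.
Proof. by split=> [x y|]; [exact: mpolyCM | exact: mpolyC1]. Qed.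

HB.instance Definition _ :=
  GRing.isAdditive.Build _ _ rightT rightT_additive.
HB.instance Definition _ :=
  GRing.isMultiplicative.Build _ _ rightT rightT_multiplicative.

Lemma envel_mul_eq0 (x y : envel F n) : x * y = 0 -> x = 0 \/ y = 0.
Proof. exact: (@mpoly_mul_eq0 n {mpoly F[n]} x y). Qed.

Lemma leftX_neq_rightT i a : leftX i - rightT a != 0.
Proof.
rewrite subr_eq0; apply/eqP.
move/(congr1 (fun t : {mpoly {mpoly F[n]}[n]} => t@_(U_(i)))).
rewrite mcoeffX eqxx mcoeffC -mdeg_eq0 mdeg1 mulr0 => /eqP.
by rewrite oner_eq0.
Qed.

End Envelope.

HB.lock Definition constT (F : fieldType) (n : nat) (c : F) : envel F n :=
  rightT c%:MP_[n].

HB.lock Definition xdiff (F : fieldType) (n j : nat) : envel F n :=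
  oapp (fun i : 'I_n => leftX F i - rightT 'X_i) 0 (insub j).

(* [stair j] substitutes the right variables for the first [j] left ones, so that
   [stair 0] and [stair n] are the left and the right embeddings of [S]. *)
HB.lock Definition stair (F : fieldType) (n j : nat) : {mpoly F[n]} -> envel F n :=
  mmap (@rightT F n \o @mpolyC n F)
    (fun i : 'I_n => if (i < j)%N then rightT 'X_i else leftX F i).

Section Staircase.
Variables (F : fieldType) (n : nat).
Local Notation S := {mpoly F[n]}.
Local Notation T := (envel F n).
Local Notation stair := (@stair F n).

Fact stair_additive j : additive (stair j).
Proof. by rewrite stair.unlock; exact: mmap_is_additive. Qed.

Fact stair_multiplicative j : multiplicative (stair j).
Proof. by rewrite stair.unlock; exact: mmap_is_multiplicative. Qed.

HB.instance Definition _ j :=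
  GRing.isAdditive.Build _ _ (stair j) (stair_additive j).
HB.instance Definition _ j :=
  GRing.isMultiplicative.Build _ _ (stair j) (stair_multiplicative j).

Lemma xvarE (R : nzRingType) (i : 'I_n) : xvar n R i = 'X_i.
Proof. by rewrite /xvar valK. Qed.

Lemma xvar_out (R : nzRingType) j : (n <= j)%N -> xvar n R j = 0.
Proof. by move=> nj; rewrite /xvar insubF // ltnNge nj. Qed.

Lemma stairC j c : stair j c%:MP = constT n c.
Proof. by rewrite constT.unlock stair.unlock mmapC. Qed.

Lemma stairX j (i : 'I_n) :
  stair j 'X_i = if (i < j)%N then rightT 'X_i else leftX F i.
Proof. by rewrite stair.unlock mmapX mmap1U. Qed.

Lemma stairZ j c a : stair j (c *: a) = constT n c * stair j a.
Proof. by rewrite -mul_mpolyC rmorphM /= stairC. Qed.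

Lemma stairDZ j c a b :
  stair j (c *: a + b) = constT n c * stair j a + stair j b.
Proof. by rewrite -stairZ; exact: rmorphD. Qed.

Lemma stairM j a b : stair j (a * b) = stair j a * stair j b.
Proof. exact: rmorphM. Qed.

Lemma stair_last a : stair n a = rightT a.
Proof.
apply: (@mpoly_rmorph_ext _ _ _ (stair n) (@rightT F n)) => [c|i].
  by rewrite /= stairC constT.unlock.
by rewrite /= stairX ltn_ord.
Qed.

(** Consecutive stairs differ on at most one variable. The boolean equality lets [xchoose] turn the
    quotient into the function [delta]. *)
Lemma stair_dvd j a :
  exists q, stair j a - stair j.+1 a == xdiff F n j * q.
Proof.
case: (ltnP j n) => [jn | nj].
  pose i := Ordinal jn.
  have [||q E] := @mpoly_rmorph_dvd _ _ _ (stair j) (stair j.+1) i a.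
  - by move=> c; rewrite /= !stairC.
  - move=> k ki; rewrite /= !stairX [(k < j.+1)%N]ltnS [(k <= j)%N]leq_eqVlt.
    by rewrite (_ : (k == j :> nat) = false) //; exact: negbTE.
  exists q; apply/eqP; rewrite E /= !stairX ltnn ltnS leqnn.
  by rewrite xdiff.unlock -[j]/(val i) valK.
exists 0; rewrite mulr0 subr_eq0; apply/eqP.
apply: mpoly_rmorph_ext => [c|i]; first by rewrite /= !stairC.
by rewrite /= !stairX !(leq_trans (ltn_ord i)) // ltnW.
Qed.

End Staircase.

HB.lock Definition delta (F : fieldType) (n j : nat) (a : {mpoly F[n]})
  : envel F n := xchoose (stair_dvd j a).

Section Delta.
Variables (F : fieldType) (n : nat).
Local Notation S := {mpoly F[n]}.
Local Notation T := (envel F n).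
Local Notation stair := (@stair F n).
Local Notation delta := (@delta F n).

Lemma deltaE j a : stair j a - stair j.+1 a = xdiff F n j * delta j a.
Proof. by rewrite delta.unlock; exact/eqP/(xchooseP (stair_dvd j a)). Qed.

Lemma xdiffE (i : 'I_n) : xdiff F n i = leftX F i - rightT 'X_i.
Proof. by rewrite xdiff.unlock valK. Qed.

(** For [j < n] the divisor is a nonzero element of a domain, so the quotient is unique; the rules
    for [delta] are verified after multiplication by the divisor. *)
Lemma deltaP j a t :
  (j < n)%N -> stair j a - stair j.+1 a = xdiff F n j * t -> delta j a = t.
Proof.
move=> jn; rewrite deltaE => /eqP; rewrite -subr_eq0 -mulrBr => /eqP.
case/envel_mul_eq0 => /eqP; last by rewrite subr_eq0 => /eqP.
by rewrite -[j]/(val (Ordinal jn)) xdiffE (negbTE (leftX_neq_rightT _ _)).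
Qed.

Lemma deltaDZ j c a b :
  (j < n)%N -> delta j (c *: a + b) = constT n c * delta j a + delta j b.
Proof.
move=> jn; apply: deltaP => //.
rewrite !stairDZ mulrDr mulrCA -!deltaE mulrBr opprD; exact: addrACA.
Qed.

Lemma deltaM j a b : (j < n)%N ->
  delta j (a * b) = stair j a * delta j b + delta j a * stair j.+1 b.
Proof.
move=> jn; apply: deltaP => //.
by rewrite !stairM mulrDr mulrCA [X in _ = _ + X]mulrA -!deltaE mulrBr mulrBl addrA addrNK.
Qed.

Lemma deltaX j l : (j < n)%N -> (l < n)%N -> delta j (xvar n _ l) = (j == l)%:R.
Proof.
move=> jn ln; apply: deltaP => //; pose i := Ordinal ln.
rewrite -[l]/(val i) xvarE !stairX /= [(l < j.+1)%N]ltnS [(l <= j)%N]leq_eqVlt.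
case: (eqVneq j l) => [-> | ne].
  by rewrite ltnn ?eqxx mulr1 -xdiffE.
by rewrite ?[l == j]eq_sym ?(negbTE ne) subrr mulr0.
Qed.

Lemma stair_sub i k a : (i <= k)%N ->
  stair i a - stair k a = \sum_(i <= j < k) xdiff F n j * delta j a.
Proof.
move=> ik; rewrite (eq_bigr (fun j => - (stair j.+1 a - stair j a))) => [|j _].
  by rewrite sumrN telescope_sumr // opprB.
by rewrite opprB deltaE.
Qed.

End Delta.

(** * The comparison map from Koszul cochains to bar cochains *)

Definition indexset (i n : nat) (J : seq nat) : bool :=
  sorted ltn J && all (fun k => i <= k < n)%N J.

Lemma indexset_cons i n j J :
  indexset i n (j :: J) = (i <= j < n)%N && indexset j.+1 n J.
Proof.
rewrite /indexset /= path_sortedE; last exact: ltn_trans.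
case ijn: (i <= j < n)%N; last by rewrite andbF.
rewrite /= [_ && sorted _ _]andbC -andbA; congr (_ && _).
rewrite -all_predI; apply: eq_all => k /=.
apply/idP/idP => [/andP[-> /andP[_ ->]] // | /andP[jk ->]].
by rewrite jk /=; case/andP: ijn => ij _; rewrite (leq_trans ij) // ltnW.
Qed.

Section StairMap.
Variables (F : fieldType) (n : nat).
Local Notation S := {mpoly F[n]}.
Local Notation T := (envel F n).
Local Notation stair := (@stair F n).
Local Notation delta := (@delta F n).
Variable M : lmodType T.
Implicit Types (phi psi : seq nat -> M) (s : seq S) (J : seq nat).

(** Unfolded: the sum over i <= j_1 < ... < j_p < n of delta_(j_1)(a_1) ... delta_(j_p)(a_p)
    phi(j_1, ..., j_p). *)
Fixpoint stairmap (i : nat) phi s : M :=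
  if s is a :: s' then
    \sum_(i <= j < n) delta j a *: stairmap j.+1 (fun J => phi (j :: J)) s'
  else phi [::].

Lemma eq_stairmap i phi psi s :
  (forall J, indexset i n J -> size J = size s -> phi J = psi J) ->
  stairmap i phi s = stairmap i psi s.
Proof.
elim: s i phi psi => [|a s IHs] i phi psi pp /=; first exact: pp.
apply: eq_big_nat => j ijn; congr (_ *: _); apply: IHs => J Jj zJ.
by apply: pp; rewrite /= ?zJ // indexset_cons ijn.
Qed.

Lemma stairmapDZ i (t : T) phi psi s :
  stairmap i (fun J => t *: phi J + psi J) s
    = t *: stairmap i phi s + stairmap i psi s.
Proof.
elim: s i phi psi => //= a s IHs i phi psi.
rewrite scaler_sumr -big_split; apply: eq_bigr => j _.
rewrite (IHs _ (fun J => phi (j :: J)) (fun J => psi (j :: J))).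
by rewrite scalerDr !scalerA mulrC.
Qed.

Lemma stairmapZ i (t : T) phi s :
  stairmap i (fun J => t *: phi J) s = t *: stairmap i phi s.
Proof.
elim: s i phi => //= a s IHs i phi.
rewrite scaler_sumr; apply: eq_bigr => j _.
by rewrite (IHs _ (fun J => phi (j :: J))) !scalerA mulrC.
Qed.

Lemma stairmapB i phi psi s :
  stairmap i (fun J => phi J - psi J) s = stairmap i phi s - stairmap i psi s.
Proof.
rewrite addrC -scaleN1r -stairmapDZ; apply: eq_stairmap => J _ _.
by rewrite scaleN1r addrC.
Qed.

Lemma multilin_stairmap i p phi :
  multilin (@constT F n) p (stairmap i phi).
Proof.
elim: p i phi => //= p IHp i phi; split=> [s sz c a b | a] /=.
  rewrite scaler_sumr -big_split; apply: eq_big_nat => j /andP[_ jn] /=.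
  by rewrite deltaDZ // scalerDl scalerA.
have: all (fun j => j < n)%N (index_iota i n).
  by apply/allP => j; rewrite mem_index_iota => /andP[].
rewrite -[mlin _ _ _ _]/(multilin (@constT F n) p _).
elim: (index_iota i n) => [_|j r IHr /= /andP[_ /IHr Hr]].
  apply: (@eq_multilin _ _ _ _ _ p (fun=> 0)) => [s _|]; first by rewrite big_nil.
  exact: multilin0.
apply: eq_multilin (multilinDZ (delta j a) (IHp j.+1 _) Hr) => s _.
by rewrite big_cons.
Qed.

(** The bound [i] varies because, after the choice of [j], the tail of the list is a cochain for the
    left action [stair j.+1], the very twist that [deltaM] creates. The remaining difference
    [stair i a - stair j a] telescopes into the Koszul terms of the indices from [i] to [j.-1]. *)
Lemma bdiff_stairmap i phi s :
  (i <= n)%N ->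
  bdiff (stair i) (stair n) (stairmap i phi) s
    = stairmap i (kosz (xdiff F n) phi) s.
Proof.
elim: s i phi => // a s IHs i phi le_in.
case: s IHs => [|b s] IHs.
  rewrite /= -scalerBl stair_sub // scaler_suml; apply: eq_bigr => j _.
  by rewrite subr0 scalerA mulrC.
pose P j (u : seq S) : M := stairmap j.+1 (fun J => phi (j :: J)) u.
have E : bmul (stair n) (stairmap i phi) a (b :: s) =
    \sum_(i <= j < n) (delta j (a * b) *: P j s
       - delta j a *: bmul (stair n) (P j) b s).
  rewrite big_split sumrN /=; congr (_ - _).
  elim: (index_iota i n) => [|j r IHr].
    rewrite big_nil (eq_bmul _ _ _ (g := fun _ => 0 *: 0)) => [|u].
      by rewrite bmulZ scale0r.
    by rewrite big_nil scale0r.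
  rewrite big_cons -IHr -bmulDZ; apply: eq_bmul => u.
  by rewrite big_cons.
transitivity (stair i a *: stairmap i phi (b :: s)
   - bmul (stair n) (stairmap i phi) a (b :: s)); first by [].
rewrite E.
have R j : (i <= j < n)%N ->
    stairmap j.+1 (fun J => kosz (xdiff F n) phi (j :: J)) (b :: s)
      = xdiff F n j *: stairmap j.+1 phi (b :: s)
        - (stair j.+1 b *: P j s - bmul (stair n) (P j) b s).
  move=> /andP[ij jn]; rewrite -[X in _ - X]/(bdiff _ _ (P j) (b :: s)).
  by rewrite IHs // -stairmapZ -stairmapB; apply: eq_stairmap.
have -> : stairmap i (kosz (xdiff F n) phi) (a :: b :: s) =
    \sum_(i <= j < n) delta j a *: (xdiff F n j *: stairmap j.+1 phi (b :: s)
        - (stair j.+1 b *: P j s - bmul (stair n) (P j) b s)).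
  by apply: eq_big_nat => j /R <-.
have -> : stair i a *: stairmap i phi (b :: s)
   = \sum_(i <= j < n) (stair i a * delta j b) *: P j s.
  by rewrite scaler_sumr; apply: eq_bigr => j _; rewrite scalerA.
(* A triangular exchange of sums: the telescoped terms, indexed by [l < j], are regrouped by [l]. *)
have X : \sum_(i <= j < n) ((stair i a - stair j a) * delta j b) *: P j s
   = \sum_(i <= j < n) (delta j a * xdiff F n j) *: stairmap j.+1 phi (b :: s).
  transitivity (\sum_(i <= j < n) \sum_(i <= l < n | (l < j)%N)
      (xdiff F n l * delta l a * delta j b) *: P j s).
    apply: eq_big_nat => j /andP[ij jn].
    rewrite stair_sub // mulr_suml scaler_suml (big_nat_widen _ _ n) ?(ltnW jn) //.
  rewrite (exchange_big_dep_nat xpredT) //=.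
  apply: eq_big_nat => l /andP[il ln].
  rewrite scaler_sumr [RHS](big_nat_widenl _ i) ?leqW //.
  apply: eq_big => [j|j _]; first by rewrite andTb.
  by rewrite scalerA (mulrC (delta l a)).
transitivity (\sum_(i <= j < n) ((stair i a - stair j a) * delta j b) *: P j s
  - \sum_(i <= j < n) delta j a *: (stair j.+1 b *: P j s
       - bmul (stair n) (P j) b s)).
  rewrite -!sumrB; apply: eq_big_nat => j /andP[_ jn].
  rewrite deltaM // mulrBl !scalerBl scalerDl scalerBr scalerA.
  have aux (x y z w : M) : x - (y + z - w) = x - y - (z - w) by zmod.
  exact: aux.
rewrite X -sumrB; apply: eq_bigr => j _.
by rewrite [RHS]scalerBr scalerA.
Qed.

End StairMap.

(** * Naturality in the coefficients, and the defect [theta] of the comparison *)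

Section RelationalNaturality.
Variables (S T : comNzRingType) (M M' : lmodType T) (R : M -> M' -> Prop).
Hypothesis R0 : R 0 0.
Hypothesis RDZ : forall t m u m' u',
  R m u -> R m' u' -> R (t *: m + m') (t *: u + u').
Variables (f : seq S -> M) (f' : seq S -> M').

Let RZ t m u : R m u -> R (t *: m) (t *: u).
Proof. by move=> r; have := RDZ t r R0; rewrite !addr0. Qed.

Let RB m u m' u' : R m u -> R m' u' -> R (m - m') (u - u').
Proof. by move=> r r'; have := RDZ (-1) r' r; rewrite !scaleN1r ![- _ + _]addrC. Qed.

(** Naturality is stated along a linear relation instead of a module map, so that the dimension
    shift can work modulo a submodule without forming quotients. *)
Lemma bmul_rel wr a s :
  (forall u, size u = size s -> R (f u) (f' u)) ->
  R (bmul wr f a s) (bmul wr f' a s).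
Proof.
elim: s a f f' => [|b s IHs] a g g' gg /=; first exact/RZ/gg.
by apply: RB; [exact: gg | apply: IHs => u su; apply: gg; rewrite /= su].
Qed.

Lemma bdiff_rel wl wr s :
  (forall u, (size u).+1 = size s -> R (f u) (f' u)) ->
  R (bdiff wl wr f s) (bdiff wl wr f' s).
Proof.
case: s => //= a s ff; apply: RB; first exact/RZ/ff.
by apply: bmul_rel => u su; apply: ff; rewrite su.
Qed.

Lemma ins_rel v s (g : seq S -> M) (g' : seq S -> M') :
  (forall u, size u = (size s).+1 -> R (g u) (g' u)) ->
  R (ins v g s) (ins v g' s).
Proof.
elim: s g g' => [|a s IHs] g g' gg /=; first by rewrite !subr0; exact: gg.
by apply: RB; [exact: gg | apply: IHs => u su; apply: gg; rewrite /= su].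
Qed.

Lemma kappa_rel x J :
  (forall u, size u = size J -> R (f u) (f' u)) ->
  R (kappa x f J) (kappa x f' J).
Proof.
elim: J f f' => [|l J IHJ] g g' gg /=; first exact: gg.
by apply: IHJ => u su; apply: ins_rel => v sv; apply: gg; rewrite sv su.
Qed.

End RelationalNaturality.

Lemma stairmap_rel (F : fieldType) n (M M' : lmodType (envel F n))
    (R : M -> M' -> Prop) (R0 : R 0 0)
    (RDZ : forall t m u m' u',
      R m u -> R m' u' -> R (t *: m + m') (t *: u + u'))
    i phi phi' (s : seq {mpoly F[n]}) :
  (forall J, size J = size s -> R (phi J) (phi' J)) ->
  R (stairmap i phi s) (stairmap i phi' s).
Proof.
elim: s i phi phi' => [|a s IHs] i phi phi' pp /=; first exact: pp.
elim: (index_iota i n) => [|j r IHr]; first by rewrite !big_nil.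
rewrite !big_cons; apply: (RDZ) IHr.
by apply: IHs => J sJ; apply: pp; rewrite /= sJ.
Qed.

Section Theta.
Variables (F : fieldType) (n : nat) (M : lmodType (envel F n)).
Implicit Types (f : seq {mpoly F[n]} -> M).

Definition hdiffT f := bdiff (@stair F n 0) (@stair F n n) f.

(** The identity minus the composite of the two comparison maps; the goal is that it sends cocycles
    to coboundaries. *)
Definition theta f s := f s - stairmap 0 (kappa (xvar n F) f) s.

Lemma xdiff_stair l :
  stair 0 (xvar n F l) - stair n (xvar n F l) = xdiff F n l.
Proof.
case: (ltnP l n) => [ln | nl]; last first.
  by rewrite xvar_out // !rmorph0 subrr xdiff.unlock insubF // ltnNge nl.
by rewrite -[l]/(val (Ordinal ln)) xvarE xdiffE !stairX ltn_ord.
Qed.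

Lemma bdiff_theta f s : hdiffT (theta f) s = theta (hdiffT f) s.
Proof.
rewrite /hdiffT bdiffB bdiff_stairmap //; congr (_ - _).
apply: eq_stairmap => J _ _; rewrite kappa_bdiff.
by congr kosz; apply/funext => l; rewrite -xdiff_stair.
Qed.

Lemma multilin_theta p f :
  multilin (@constT F n) p f -> multilin (@constT F n) p (theta f).
Proof. by move=> fp; apply: multilinB => //; exact: multilin_stairmap. Qed.

Lemma multilin_hdiffT p f :
  multilin (@constT F n) p f -> multilin (@constT F n) p.+1 (hdiffT f).
Proof. by apply: multilin_bdiff => c a; exact: stairZ. Qed.

End Theta.

Lemma theta_rel (F : fieldType) n (M M' : lmodType (envel F n))
    (R : M -> M' -> Prop) (R0 : R 0 0)
    (RDZ : forall t m u m' u',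
      R m u -> R m' u' -> R (t *: m + m') (t *: u + u'))
    f f' (s : seq {mpoly F[n]}) :
  (forall u, size u = size s -> R (f u) (f' u)) ->
  R (theta f s) (theta f' s).
Proof.
move=> ff; have RB m u m' u' : R m u -> R m' u' -> R (m - m') (u - u').
  move=> r r'; have := RDZ (-1) _ _ _ _ r' r.
  by rewrite !scaleN1r ![- _ + _]addrC.
apply: RB; first exact: ff.
apply: stairmap_rel => // J sJ; apply: kappa_rel => // u su.
by apply: ff; rewrite su.
Qed.

(** * Coinduced modules and dimension shifting *)

Section MonomialSum.
Variables (F : fieldType) (n : nat) (M : lmodType (envel F n)).
Implicit Types (G : 'X_{1..n} -> M) (t : {mpoly {mpoly F[n]}[n]}).

Definition monsum G t : M := \sum_(m <- msupp t) rightT t@_m *: G m.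

Lemma monsumE G t (r : seq 'X_{1..n}) :
  uniq r -> {subset msupp t <= r} ->
  monsum G t = \sum_(m <- r) rightT t@_m *: G m.
Proof.
move=> Ur sub; rewrite [RHS](bigID (mem (msupp t))) /= [X in _ + X]big1 ?addr0.
  rewrite -[RHS]big_filter; apply: perm_big; apply: uniq_perm => [||m].
  - exact: msupp_uniq.
  - exact: filter_uniq.
  by rewrite mem_filter; case: (boolP (m \in msupp t)) => //= /sub ->.
by move=> m /memN_msupp_eq0 ->; rewrite rmorph0 scale0r.
Qed.

Lemma monsumD G t t' : monsum G (t + t') = monsum G t + monsum G t'.
Proof.
pose r := undup (msupp t ++ msupp t').
have Ur : uniq r by exact: undup_uniq.
rewrite !(@monsumE G _ r) //.
- by rewrite -big_split; apply: eq_bigr => m _; rewrite mcoeffD rmorphD scalerDl.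
- by move=> m h; rewrite mem_undup mem_cat h orbT.
- by move=> m h; rewrite mem_undup mem_cat h.
by move=> m /msuppD_le h; rewrite mem_undup.
Qed.

Lemma monsumZX G c m : monsum G (c *: 'X_[m]) = rightT c *: G m.
Proof.
rewrite (@monsumE G _ [:: m]) // ?big_seq1 ?mcoeffZ ?mcoeffX ?eqxx ?mulr1 //.
by move=> k /msuppZ_le; rewrite msuppX.
Qed.

Lemma monsum0 G : monsum G 0 = 0.
Proof. by rewrite /monsum msupp0 big_nil. Qed.

Lemma stair0X mu : stair 0 'X_[mu] = 'X_[mu] :> {mpoly {mpoly F[n]}[n]}.
Proof. by rewrite stair.unlock mmapX mpolyXE_id. Qed.

Lemma envel_scaleE c t : rightT c * (t : envel F n) = c *: t.
Proof. exact: mul_mpolyC. Qed.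

Lemma monsum_scale t (m : M) :
  monsum (fun mu => stair 0 'X_[mu] *: m) t = (t : envel F n) *: m.
Proof.
elim/mpolyind: t => [|c mu t _ _ IHt]; first by rewrite monsum0 (scale0r m).
rewrite monsumD IHt monsumZX scalerA stair0X envel_scaleE.
by rewrite [RHS](scalerDl m).
Qed.

Lemma monsumDG G G' t :
  monsum (fun mu => G mu + G' mu) t = monsum G t + monsum G' t.
Proof. by rewrite -big_split; apply: eq_bigr => mu _; rewrite scalerDr. Qed.

Lemma monsumZG G (e : envel F n) t :
  monsum (fun mu => e *: G mu) t = e *: monsum G t.
Proof.
by rewrite scaler_sumr; apply: eq_bigr => mu _; rewrite !scalerA mulrC.
Qed.

End MonomialSum.

(* The coinduced module: a function on monomials stands for the map from the
   enveloping algebra to [M] that is linear over the right action. *)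
Definition coind (F : fieldType) n (M : lmodType (envel F n)) : Type :=
  'X_{1..n} -> M.

Section Coinduced.
Variables (F : fieldType) (n : nat) (M : lmodType (envel F n)).
Local Notation T := (envel F n).
Local Notation coind := (coind M).

HB.instance Definition _ := GRing.Zmodule.on coind.

(** Left variables translate the argument and right coefficients act on the values: the action on
    maps out of the enveloping algebra, read on its monomial basis. *)
Definition coind_scale (t : T) (u : coind) : coind :=
  fun mu => monsum (fun nu => u (mu + nu)%MM) t.

Fact coind_scaleA a b u :
  coind_scale a (coind_scale b u) = coind_scale (a * b) u.
Proof.
apply/funext => mu; rewrite /coind_scale.
elim/mpolyind: a => [|c m a _ _ IHa]; first by rewrite (mul0r b) !monsum0.
rewrite [(_ + _) * b]mulrDl !monsumD IHa !monsumZX; congr (_ + _).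
elim/mpolyind: b {a IHa} => [|c' m' b _ _ IHb].
  by rewrite (mulr0 (_ : T)) !monsum0 scaler0.
rewrite (mulrDr (_ : T)) !monsumD scalerDr IHb !monsumZX; congr (_ + _).
have -> : (c *: 'X_[m] : T) * (c' *: 'X_[m'] : T)
    = (c * c') *: 'X_[m + m'] :> {mpoly {mpoly F[n]}[n]}.
  rewrite mpolyXD -scalerAl -scalerAr scalerA; reflexivity.
by rewrite monsumZX rmorphM scalerA addmA.
Qed.

Fact coind_scale1 u : coind_scale 1 u = u.
Proof.
apply/funext => mu; rewrite /coind_scale.
have -> : (1 : T) = (1 : {mpoly F[n]}) *: 'X_[0%MM] :> {mpoly {mpoly F[n]}[n]}.
  by rewrite scale1r mpolyX0.
by rewrite monsumZX rmorph1 scale1r addm0.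
Qed.

Fact coind_scaleDr : right_distributive coind_scale +%R.
Proof. by move=> t u v; apply/funext => mu; exact: monsumDG. Qed.

Fact coind_scaleDl u : {morph coind_scale^~ u : a b / a + b}.
Proof. by move=> a b; apply/funext => mu; exact: monsumD. Qed.

HB.instance Definition _ := GRing.Zmodule_isLmodule.Build T coind
  coind_scaleA coind_scale1 coind_scaleDr coind_scaleDl.

Implicit Types (u : coind) (f : seq {mpoly F[n]} -> M).

Lemma coindE t u mu : (t *: u) mu = monsum (fun nu => u (mu + nu)%MM) t.
Proof. by []. Qed.

Lemma coindDE u v mu : (u + v) mu = u mu + v mu. Proof. by []. Qed.
Lemma coindNE u mu : (- u) mu = - u mu. Proof. by []. Qed.

Lemma coind_right c u mu : (rightT c *: u) mu = rightT c *: u mu.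
Proof.
transitivity (monsum (fun nu => u (mu + nu)%MM) (c *: 'X_[0%MM])).
  by rewrite coindE; congr monsum; rewrite mpolyX0 -mul_mpolyC mulr1.
by rewrite monsumZX addm0.
Qed.

Lemma coind_constT c u mu : (constT n c *: u) mu = constT n c *: u mu.
Proof. by rewrite constT.unlock coind_right. Qed.

Lemma bmul_coind (g : seq {mpoly F[n]} -> coind) a s mu :
  bmul (@stair F n n) g a s mu = bmul (@stair F n n) (fun v => g v mu) a s.
Proof.
elim: s a g => [|b s IHs] a g /=; first by rewrite stair_last coind_right.
by rewrite coindDE coindNE IHs.
Qed.

Lemma multilin_coind p (g : seq {mpoly F[n]} -> coind) :
  (forall mu, multilin (@constT F n) p (fun s => g s mu)) <->
  multilin (@constT F n) p g.
Proof.
elim: p g => //= p IHp g; split=> [gp | [g1 g2] mu]; split.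
- move=> s sz c a b; apply/funext => mu; have [gmu _] := gp mu.
  by rewrite coindDE coind_constT gmu.
- move=> a; have [h _] := IHp (fun s => g (a :: s)).
  by apply: h => mu; have [_ h'] := gp mu; exact: h' a.
- by move=> s sz c a b; rewrite g1 // coindDE coind_constT.
- move=> a; have [_ h] := IHp (fun s => g (a :: s)).
  exact: h (g2 a) mu.
Qed.

Definition lift_coind f : seq {mpoly F[n]} -> coind :=
  fun s mu => f ('X_[mu] :: s).

Lemma lift_coind_left p f a s mu : multilin (@constT F n) p.+1 f -> size s = p ->
  (stair 0 a *: lift_coind f s) mu = f ('X_[mu] * a :: s).
Proof.
case=> fl _ sz; rewrite coindE.
elim/mpolyind: a => [|c m a _ _ IHa].
  rewrite rmorph0 monsum0 mulr0 -(addNr (0 : {mpoly F[n]})) -[- 0]scaleN1r fl //.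
  by rewrite constT.unlock !rmorphN1 scaleN1r addNr.
rewrite stairDZ monsumD IHa mulrDr -scalerAr fl //; congr (_ + _).
rewrite stair0X constT.unlock.
have -> : rightT c%:MP * ('X_[m] : envel F n)
    = c%:MP *: 'X_[m] :> {mpoly {mpoly F[n]}[n]} by exact: mul_mpolyC.
by rewrite monsumZX /lift_coind mpolyXD.
Qed.

(** When [f] is a cocycle the last term vanishes. Thus, with [m] in [M] identified with the function
    sending [mu] to ['X_[mu]] times [m], the cocycle [f] becomes the coboundary of
    [lift_coind f]. *)
Lemma bdiff_lift_coind p f a s mu : multilin (@constT F n) p.+1 f -> size s = p ->
  hdiffT (lift_coind f) (a :: s) mu
    = stair 0 'X_[mu] *: f (a :: s) - hdiffT f ('X_[mu] :: a :: s).
Proof.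
move=> fp sz; rewrite /hdiffT /= coindDE coindNE bmul_coind.
by rewrite (lift_coind_left _ _ fp sz) subKr.
Qed.

End Coinduced.

(* Dimension shifting. A cochain that is a cocycle modulo [N] lifts to a
   [(p-1)]-cochain in the coinduced module, a cocycle modulo the submodule of
   the functions that agree modulo [N] with the translates of an element of
   [M]. *)
Theorem theta_coboundary (F : fieldType) n p (M : lmodType (envel F n))
    (N : M -> Prop) (f : seq {mpoly F[n]} -> M) :
  N 0 -> (forall t m m', N m -> N m' -> N (t *: m + m')) ->
  multilin (@constT F n) p f ->
  (forall s, size s = p.+1 -> N (hdiffT f s)) ->
  exists2 w, multilin (@constT F n) p.-1 w
    & forall s, size s = p -> N (theta f s - hdiffT w s).
Proof.
elim: p M N f => [|p IHp] M N f N0 NDZ fp Nf.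
  (* On the empty list both comparison maps are the identity, so [theta f] is 0. *)
  exists (fun=> 0) => // s /size0nil ->; rewrite /theta /= subr0 subrr.
  exact: N0.
have NZ t m : N m -> N (t *: m) by move=> /(NDZ t) /(_ N0); rewrite addr0.
have NB m m' : N m -> N m' -> N (m - m').
  by move=> Nm Nm'; rewrite addrC -scaleN1r; exact: NDZ.
have Nsum I (r : seq I) (t : I -> envel F n) (G : I -> M) :
    (forall i, N (G i)) -> N (\sum_(i <- r) t i *: G i).
  by move=> NG; elim: r => [|i r IHr]; rewrite ?big_nil // big_cons; exact: NDZ.
(* [R m u] says that [u] is, modulo [N], the image of [m] in the coinduced module. *)
pose R (m : M) (u : coind M) := forall mu, N (u mu - stair 0 'X_[mu] *: m).
have R0 : R 0 0 by move=> mu; rewrite scaler0 subr0.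
have RDZ t m u m' u' : R m u -> R m' u' -> R (t *: m + m') (t *: u + u').
  move=> Rm Rm' mu.
  have -> : (t *: u + u') mu - stair 0 'X_[mu] *: (t *: m + m')
     = monsum (fun nu => u (mu + nu)%MM - stair 0 'X_[mu + nu] *: m) t
       + (u' mu - stair 0 'X_[mu] *: m').
    have -> : monsum (fun nu => u (mu + nu)%MM - stair 0 'X_[mu + nu] *: m) t
        = (t *: u) mu - stair 0 'X_[mu] *: (t *: m).
      rewrite coindE -[t *: m]monsum_scale -monsumZG /monsum -sumrB.
      by apply: eq_bigr => nu _; rewrite mpolyXD rmorphM -scalerBr scalerA.
    by rewrite coindDE scalerDr opprD addrACA.
  by rewrite -[X in N (X + _)]scale1r; apply: NDZ => //; exact: Nsum.
pose N' (u : coind M) := exists m, R m u.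
have N'0 : N' 0 by exists 0.
have N'DZ t u u' : N' u -> N' u' -> N' (t *: u + u').
  by case=> m Rm [m' Rm']; exists (t *: m + m'); exact: RDZ.
pose f' := lift_coind f.
have f'p : multilin (@constT F n) p f'.
  by apply/multilin_coind => mu; case: fp => _; exact.
have Rf s : size s = p.+1 -> R (f s) (hdiffT f' s).
  case: s => // a s [sz] mu; rewrite (bdiff_lift_coind _ _ fp sz).
  rewrite addrC addKr -[X in N X]add0r; apply: NB => //.
  by apply: Nf; rewrite /= sz.
have [|w' w'p Nw'] := IHp (coind M) N' f' N'0 N'DZ f'p.
  by move=> s /Rf Rs; exists (f s).
pose v' s := theta f' s - hdiffT w' s.
pose v s := v' s 0%MM.
have v'p : multilin (@constT F n) p v'.
  apply: multilinB; first exact: multilin_theta.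
  by case: (p) w'p => // q; exact: multilin_hdiffT.
exists v; first by move/multilin_coind: v'p; exact.
(* Evaluation at the trivial monomial recovers [m] modulo [N], so [v s] can replace the element that
   [N'] only asserts to exist. *)
have Rv s : size s = p -> R (v s) (v' s).
  move=> /Nw' [m Rm] mu; have := NB _ _ (Rm mu) (NZ (stair 0 'X_[mu]) _ (Rm 0%MM)).
  rewrite mpolyX0 rmorph1 scale1r scalerBr opprB addrA.
  by rewrite addrNK.
move=> s sz.
have Rth : R (theta f s) (theta (hdiffT f') s).
  by apply: theta_rel => // u su; apply: Rf; rewrite su.
have Rdv : R (hdiffT v s) (hdiffT v' s).
  by apply: bdiff_rel => // u [su]; apply: Rv; move: su; rewrite sz => -[].
(* The term from [w'] dies by d^2 = 0. The common value represents, modulo [N], both [hdiffT v s]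
   and [theta f s], which are then compared at the trivial monomial. *)
have E : hdiffT v' s = theta (hdiffT f') s.
  by rewrite -bdiff_theta /hdiffT bdiffB bdiff_bdiff subr0.
have := NB _ _ (Rdv 0%MM) (Rth 0%MM); rewrite E mpolyX0 rmorph1 !scale1r.
by rewrite opprB addrC addrA addrNK.
Qed.

(** * Exactness of the Koszul complex of a regular sequence *)

Section KoszulAlgebra.
Variables (T : comNzRingType) (M : lmodType T) (e : nat -> T).
Implicit Types (phi psi sigma : seq nat -> M) (J : seq nat).

Lemma koszZ (t : T) phi J :
  kosz e (fun u => t *: phi u) J = t *: kosz e phi J.
Proof.
elim: J phi => [|l J IHJ] phi /=; first by rewrite scaler0.
by rewrite (IHJ (fun u => phi (l :: u))) scalerBr !scalerA mulrC.
Qed.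

Lemma kosz_kosz phi J : kosz e (kosz e phi) J = 0.
Proof.
elim: J phi => //= l J IHJ phi.
by rewrite koszB koszZ IHJ subr0 subrr.
Qed.

Lemma kosz_eq0 sigma J :
  (forall J1 l J2, J = J1 ++ l :: J2 -> e l *: sigma (J1 ++ J2) = 0) ->
  kosz e sigma J = 0.
Proof.
elim: J sigma => //= l J IHJ sigma s0.
rewrite (s0 [::] l J) // IHJ ?subr0 // => J1 k J2 EJ.
by rewrite (s0 (l :: J1) k J2) // EJ.
Qed.

Lemma indexset_widen i j n J :
  (i <= j)%N -> indexset j n J -> indexset i n J.
Proof.
move=> ij /andP[sJ aJ]; rewrite /indexset sJ; apply: sub_all aJ => k /andP[jk ->].
by rewrite (leq_trans ij).
Qed.

Lemma kosz_sub (N : M -> Prop) i n phi J :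
  N 0 -> (forall t m m', N m -> N m' -> N (t *: m + m')) ->
  indexset i n J ->
  (forall J', indexset i n J' -> (size J').+1 = size J -> N (phi J')) ->
  N (kosz e phi J).
Proof.
move=> N0 NDZ; elim: J i phi => //= l J IHJ i phi.
rewrite indexset_cons => /andP[il lJ] Np.
have Nk : N (kosz e (fun u => phi (l :: u)) J).
  apply: (IHJ l.+1) => // J' lJ' zJ'; apply: Np; last by rewrite /= zJ'.
  by rewrite indexset_cons il.
have Nl : N (phi J).
  by apply: Np => //; apply: indexset_widen lJ; case/andP: il => il _; exact: leqW.
have := NDZ (-1) _ _ Nk (NDZ (e l) _ _ Nl N0).
by rewrite addr0 scaleN1r addrC.
Qed.

Lemma eq_kosz_indexset i n phi psi J :
  indexset i n J ->
  (forall J', indexset i n J' -> (size J').+1 = size J -> phi J' = psi J') ->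
  kosz e phi J = kosz e psi J.
Proof.
move=> iJ pp; apply/eqP; rewrite -subr_eq0 -koszB; apply/eqP.
apply: (@kosz_sub (fun m => m = 0) i n _ J) => // [t m m' -> ->|J' iJ' zJ'].
  by rewrite scaler0 addr0.
by rewrite pp // subrr.
Qed.

Variables (d n : nat) (I : nat -> M -> Prop).
Hypothesis le_dn : (d <= n)%N.
Hypothesis I0 : forall i, I i 0.
Hypothesis IDZ : forall i t m m', I i m -> I i m' -> I i (t *: m + m').
Hypothesis I_reg : forall i m, (i < d)%N -> I i (e i *: m) -> I i m.
Hypothesis IS : forall i m, (i < d)%N -> I i m -> I i.+1 m.
Hypothesis I_e : forall i m, (i < d)%N -> I i.+1 (e i *: m).
Hypothesis I_div : forall i m, (i < d)%N -> I i.+1 m -> exists m', I i (m - e i *: m').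
Hypothesis e0 : forall l, (d <= l)%N -> e l = 0.

Let IB i m m' : I i m -> I i m' -> I i (m - m').
Proof. by move=> h h'; have := IDZ (-1) h' h; rewrite scaleN1r addrC. Qed.

(* Exactness of the Koszul complex of a regular sequence below the top degree,
   by descending induction on [i]: [I i] stands for the submodule generated by
   [e 0, ..., e i.-1]. *)
Lemma kosz_exact_from k i p phi : (i + k)%N = d ->
  (forall J, indexset i n J -> size J = p.+1 -> I i (kosz e phi J)) ->
  exists psi sigma,
    (forall J, indexset i n J -> size J = p ->
       I i (phi J - kosz e psi J - sigma J))
    /\ forall J, ~~ all (mem J) (iota i k) -> sigma J = 0.
Proof.
elim: k i p phi => [|k IHk] i p phi ik cphi.
  exists (fun=> 0), phi; split=> // J iJ _.
  by rewrite addrAC subrr kosz_eq0 ?subr0 // => *; rewrite scaler0.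
have ltid : (i < d)%N by rewrite -ik addnS ltnS leq_addr.
have ltin : (i < n)%N by exact: leq_trans le_dn.
(* In degree 0 the value of [kosz e phi] at [[:: i]] is [e i *: phi [::]], and regularity removes
   the factor. *)
case: p cphi => [|q] cphi.
  exists (fun=> 0), (fun=> 0); split=> // J iJ /size0nil ->.
  rewrite /= !subr0; apply: I_reg => //; have := cphi [:: i].
  by rewrite /= subr0; apply; rewrite // indexset_cons leqnn ltin.
pose phii J := phi (i :: J).
have iS J : indexset i.+1 n J -> indexset i n (i :: J).
  by rewrite indexset_cons leqnn ltin.
have [||psi1 [sig1 [E1 Z1]]] := IHk i.+1 q phii.
- by rewrite addSnnS.
(* Modulo [I i.+1] the term [e i *: phi J] disappears, so [phii] is a cocycle for the sequence that
   starts at [i.+1]. *)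
- move=> J iJ zJ; have := cphi _ (iS _ iJ); rewrite /= zJ => /(_ erefl) /IS h.
  have := IB (I_e (phi J) ltid) (h ltid).
  by rewrite subKr.
have /choice[tau Etau] J : exists m', indexset i.+1 n J -> size J = q ->
    I i (phii J - kosz e psi1 J - sig1 J - e i *: m').
  case: (boolP (indexset i.+1 n J)) => [iJ | _]; last by exists 0.
  case: (eqVneq (size J) q) => [zJ | /eqP zJ]; last by exists 0.
  by have [m' h] := I_div ltid (E1 J iJ zJ); exists m'.
(* The sign makes [kosz e psi (i :: J)] equal to [e i *: tau J + kosz e psi1 J], which settles the
   sequences that start with [i]. *)
pose psi J := if J is j :: J' then (if j == i then - psi1 J' else tau J) else tau J.
pose sig J := if J is j :: J' then (if j == i then sig1 J' else 0) else 0.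
have psiE J : indexset i.+1 n J -> psi J = tau J.
  case: J => //= j J; rewrite indexset_cons => /andP[/andP[ij _] _].
  by rewrite gtn_eqF.
have Ei J : indexset i.+1 n J -> size J = q ->
    I i (phii J - kosz e psi (i :: J) - sig1 J).
  move=> iJ zJ; have := Etau J iJ zJ; rewrite /= psiE //.
  have -> : kosz e (fun u => psi (i :: u)) J = - kosz e psi1 J.
    rewrite -scaleN1r -koszZ; apply: eq_kosz => u.
    by rewrite /psi eqxx scaleN1r.
  have -> // : forall x y z w : M, x - y - z - w = x - (w - - y) - z.
  by move=> x y z w; zmod.
exists psi, sig; split; last first.
  case=> [|j J] //=; case: eqP => [-> | //]; rewrite inE eqxx /= => nJ.
  apply: Z1; apply: contra nJ; rewrite /=; apply: sub_all => l /=.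
  by rewrite inE => ->; rewrite orbT.
case=> [|j J] // ijJ [zJ].
have [ij | ij] := eqVneq j i.
  rewrite {}ij in ijJ *; rewrite /sig eqxx; apply: Ei => //.
  by move: ijJ; rewrite indexset_cons => /andP[].
have iJ : indexset i.+1 n (j :: J).
  move: ijJ; rewrite !indexset_cons => /andP[/andP[lij ->] ->].
  by rewrite ltn_neqAle eq_sym ij lij.
rewrite /sig (negbTE ij) subr0; set J' := j :: J.
pose phi' u := phi u - kosz e psi u.
(* For a sequence without [i], the value of [kosz e phi'] at [i :: J'] expresses [e i *: phi' J']
   through values on sequences with [i], and regularity cancels [e i]. *)
apply: I_reg => //; rewrite -/(phi' J').
have -> : e i *: phi' J' = kosz e phi' (i :: J')
    + (kosz e (fun u => phi' (i :: u) - sig1 u) J' + kosz e sig1 J').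
  by rewrite koszB /=; zmod.
have -> : kosz e phi' (i :: J') = kosz e phi (i :: J').
  by rewrite koszB kosz_kosz subr0.
(* Removing an index [l < d] destroys the containment that [sig1] requires, and for [d <= l] the
   factor [e l] is 0. *)
rewrite [kosz e sig1 _]kosz_eq0 ?addr0; last first.
  move=> J1 l J2 EJ; case: (ltnP l d) => [ld | /e0 ->]; last exact: scale0r.
  have: uniq (J1 ++ l :: J2).
    by rewrite -EJ; case/andP: iJ => sJ _; exact: (sorted_uniq ltn_trans ltnn).
  rewrite cat_uniq /= negb_or => /and3P[_ /andP[lJ1 _] /andP[lJ2 _]].
  rewrite Z1 ?scaler0 //; apply/allPn; exists l; last first.
    by rewrite /= mem_cat negb_or lJ1 lJ2.
  rewrite mem_iota addSnnS ik ld andbT.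
  have : l \in J' by rewrite EJ mem_cat inE eqxx orbT.
  by case/andP: iJ => _ /allP h /h /andP[].
rewrite -[kosz e phi _]scale1r; apply: IDZ.
  apply: cphi; first by rewrite indexset_cons leqnn ltin.
  by rewrite /= zJ.
apply: (@kosz_sub _ i.+1 n) => [//|t m m'|//|u iu zu]; first exact: IDZ.
by apply: Ei => //; move: zu; rewrite /= zJ => -[].
Qed.

End KoszulAlgebra.

(** * Wedge products of functionals as minors *)

Section Wedge.
Variable K : comNzRingType.
Implicit Types (h : nat -> K) (phi : seq nat -> K) (J : seq nat).

Fixpoint wedge h phi J : K :=
  if J is l :: J' then h l * phi J' - wedge h (fun u => phi (l :: u)) J' else 0.

Fixpoint wedges (rows : seq (nat -> K)) J : K :=
  if rows is h :: rows' then wedge h (wedges rows') J else (J == [::])%:R.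

Definition delnth (T : Type) k (s : seq T) := take k s ++ drop k.+1 s.

Lemma wedgeE h phi J :
  wedge h phi J
    = \sum_(k < size J) (-1) ^+ k * h (nth 0%N J k) * phi (delnth k J).
Proof.
elim: J phi => [|l J IHJ] phi /=; first by rewrite big_ord0.
rewrite big_ord_recl expr0 mul1r /delnth /= drop0; congr (_ + _).
rewrite IHJ -sumrN; apply: eq_bigr => k _.
by rewrite /bump /= add1n exprS mulN1r !mulNr.
Qed.

Lemma size_delnth (T : Type) k (s : seq T) :
  (k < size s)%N -> size (delnth k s) = (size s).-1.
Proof.
move=> ks; rewrite size_cat size_take size_drop ks.
by move: ks; case: (size s) => // m; rewrite ltnS subSS /= => /subnKC.
Qed.

Lemma nth_delnth (T : Type) (x : T) k (s : seq T) j :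
  (k < size s)%N -> nth x (delnth k s) j = nth x s (bump k j).
Proof.
move=> ks; rewrite nth_cat size_take ks /bump [(k <= j)%N]leqNgt.
case: ltnP => jk /=; first by rewrite nth_take.
by rewrite nth_drop addSn subnKC.
Qed.

(** The recursion of [wedge] is the Laplace expansion along the first row. *)
Lemma wedges_det rows J p : size rows = p -> size J = p ->
  wedges rows J
    = \det (\matrix_(i < p, j < p) nth (fun=> 0) rows i (nth 0%N J j)).
Proof.
elim: p rows J => [|p IHp] [|h rows] // J => [_ /size0nil -> | [zr] zJ].
  by rewrite det_mx00.
rewrite (expand_det_row _ ord0) /= wedgeE zJ; apply: eq_bigr => k _.
rewrite !mxE /cofactor add0n mulrCA mulrA; congr (_ * _).
have kJ : (k < size J)%N by rewrite zJ.
rewrite IHp ?size_delnth ?zJ //; congr (\det _).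
by apply/matrixP => i j; rewrite !mxE nth_delnth.
Qed.

End Wedge.

Section DualWedges.
Variables (K : comNzRingType) (d n : nat) (rows : seq (nat -> K)).
Hypothesis size_rows : size rows = d.
Hypothesis rows0 : forall i l, (i < d)%N -> (d <= l)%N -> nth (fun=> 0) rows i l = 0.
Let c := \det (\matrix_(i < d, j < d) nth (fun=> 0) rows i j).

Lemma indexset_uniq i m J : indexset i m J -> uniq J.
Proof. by case/andP=> sJ _; exact: (sorted_uniq ltn_trans ltnn). Qed.

Lemma indexset_perm i m J J' :
  indexset i m J -> sorted ltn J' -> perm_eq J J' -> J = J'.
Proof.
case/andP=> sJ _ sJ' /perm_mem JJ'.
exact: (irr_sorted_eq ltn_trans ltnn sJ sJ' JJ').
Qed.

(** Any other index set of size [d] has an entry at least [d], hence a zero column in its minor. *)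
Lemma wedges_iota J : indexset 0 n J -> size J = d ->
  wedges rows J = c * (J == iota 0 d)%:R.
Proof.
move=> iJ zJ; rewrite (wedges_det size_rows zJ).
have [-> | nJ] := eqVneq J (iota 0 d).
  rewrite mulr1; congr (\det _); apply/matrixP => i j.
  by rewrite !mxE nth_iota.
have [k kd dk] : exists2 k, (k < d)%N & (d <= nth 0%N J k)%N.
  have /allPn[l lJ] : ~~ all (fun l => l < d)%N J.
    apply: contra nJ => /allP Jd; apply/eqP.
    apply: (indexset_perm iJ); first exact: iota_ltn_sorted.
    apply: uniq_perm; rewrite ?iota_uniq ?(indexset_uniq iJ) //.
    apply: (uniq_min_size (indexset_uniq iJ) _ _).2.
      by move=> l /Jd; rewrite mem_iota.
    by rewrite size_iota zJ.
  rewrite -leqNgt => dl; exists (index l J); last by rewrite nth_index.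
  by rewrite -zJ index_mem.
rewrite mulr0 (expand_det_col _ (Ordinal kd)) big1 // => i _.
by rewrite mxE rows0 ?mul0r.
Qed.

Definition dual_row (j l : nat) : K := (l == j)%:R.

(** The dual rows select the columns [J'] and leave the leading minor [c]; the sign comes from
    moving its [d] columns past those of [J']. Up to the factor, these wedges are indicators of the
    index sets that contain 0, ..., d-1. *)
Lemma wedges_dual J' J : indexset d n J' -> indexset 0 n J ->
  size J = (size J' + d)%N ->
  wedges ([seq dual_row j | j <- J'] ++ rows) J
    = (-1) ^+ (d * size J') * c * (J == iota 0 d ++ J')%:R.
Proof.
elim: J' J => [|j J' IHJ'] J /= jJ' iJ zJ.
  by rewrite muln0 expr0 mul1r cats0; exact: wedges_iota.
move: jJ'; rewrite indexset_cons => /andP[/andP[dj jn] jJ'].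
have dJ' : indexset d n J' by apply: indexset_widen jJ'; exact: leqW.
have idel k : (k < size J)%N -> indexset 0 n (delnth k J).
  case/andP: iJ => sJ /allP aJ _.
  have sub : subseq (delnth k J) J.
    rewrite -[X in subseq _ X](cat_take_drop k J) cat_subseq ?subseq_refl //.
    by rewrite -add1n -drop_drop; exact: drop_subseq.
  rewrite /indexset (subseq_sorted ltn_trans sub sJ).
  by apply/allP => l /(mem_subseq sub); exact: aJ.
have zdel k : (k < size J)%N -> size (delnth k J) = (size J' + d)%N.
  by move=> kJ; rewrite size_delnth // zJ addSn.
rewrite wedgeE.
(* In the expansion along the dual row of [j] only position [d] contributes: there [j] stands in
   [iota 0 d ++ j :: J']. *)
rewrite (eq_bigr (fun k : 'I_(size J) =>
   ((J == iota 0 d ++ j :: J') && (k == d :> nat))%:R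
   * ((-1) ^+ d * ((-1) ^+ (d * size J') * c)))) => [|k _]; last first.
  rewrite IHJ' ?idel ?zdel // /dual_row; have kJ := ltn_ord k.
  have [EJ | nJ] := eqVneq J.
    have Ek : (nth 0%N J k == j) = (k == d :> nat).
      rewrite -[j in LHS](_ : nth 0%N J d = j); last first.
        by rewrite EJ nth_cat size_iota ltnn subnn.
      by rewrite nth_uniq ?(indexset_uniq iJ) // zJ addSn ltnS leq_addl.
    rewrite Ek /=; case: eqP => [-> | _]; last by rewrite mulr0 !mul0r.
    have -> : delnth d J = iota 0 d ++ J'.
      rewrite EJ /delnth take_size_cat ?size_iota // drop_cat size_iota.
      by rewrite ltnNge leqnSn /= subSnn /= drop0.
    by rewrite eqxx !mulr1 mul1r.
  rewrite mul0r; case: eqP => [Ek | _]; last by rewrite mulr0 mul0r.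
  case: eqP => [Ed | _]; last by rewrite !mulr0.
  case/eqP: nJ; apply: (indexset_perm iJ).
    rewrite (sorted_pairwise ltn_trans) pairwise_cat.
    rewrite -!(sorted_pairwise ltn_trans) iota_ltn_sorted.
    have : indexset d n (j :: J') by rewrite indexset_cons dj jn.
    case/andP => -> /allP ge_d; rewrite !andbT.
    apply/allrelP => x y; rewrite mem_iota => /= xd /ge_d /andP[dy _].
    exact: leq_trans dy.
  rewrite -{1}(cat_take_drop k J) (drop_nth 0%N) // Ek.
  rewrite -(cat1s j (drop _ _)) perm_catCA perm_sym -(cat1s j J') perm_catCA.
  by rewrite perm_cat2l -Ed.
rewrite mulnS exprD -!mulrA; set X := _ ^+ d * _.
case: eqP => [EJ | _]; last first.
  by rewrite big1 ?mulr0 // => k _; rewrite mul0r.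
have dJ : (d < size J)%N by rewrite zJ addSn ltnS leq_addl.
rewrite (bigD1 (Ordinal dJ)) //= eqxx mul1r big1 ?addr0 ?mulr1 // => k.
by rewrite -val_eqE /= => /negbTE ->; rewrite mul0r.
Qed.

End DualWedges.

(** * Twisted coefficients and cup products of twisted derivations *)

Definition twM (S T : comNzRingType) (rho : T -> S) : Type := S.

Section TwistedModule.
Variables (S T : comNzRingType) (rho : {rmorphism T -> S}).
HB.instance Definition _ := GRing.Zmodule.on (twM rho).
Definition tw_scale (t : T) (m : twM rho) : twM rho := rho t * (m : S).
Fact tw_scaleA a b u : tw_scale a (tw_scale b u) = tw_scale (a * b) u.
Proof. by rewrite /tw_scale mulrA rmorphM. Qed.
Fact tw_scale1 u : tw_scale 1 u = u.
Proof. by rewrite /tw_scale rmorph1 mul1r. Qed.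
Fact tw_scaleDr : right_distributive tw_scale +%R.
Proof. by move=> t u v; exact: mulrDr. Qed.
Fact tw_scaleDl u : {morph tw_scale^~ u : a b / a + b}.
Proof. by move=> a b; rewrite /tw_scale rmorphD; exact: mulrDl. Qed.
HB.instance Definition _ := GRing.Zmodule_isLmodule.Build T (twM rho)
  tw_scaleA tw_scale1 tw_scaleDr tw_scaleDl.

Lemma twME (t : T) (m : twM rho) : t *: m = rho t * (m : S) :> S.
Proof. by []. Qed.

Implicit Types (f : seq S -> twM rho).

Lemma ins_raddf (g : {additive S -> S}) v f s :
  ins v (fun u => g (f u) : twM rho) s = g (ins v f s).
Proof.
elim: s f => [|a s IHs] f /=; first by rewrite !subr0.
by rewrite (IHs (fun u => f (a :: u))); exact/esym/raddfB.
Qed.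

Lemma kappa_raddf (g : {additive S -> S}) x f J :
  kappa x (fun u => g (f u) : twM rho) J = g (kappa x f J).
Proof.
elim: J f => //= l J IHJ f; rewrite -IHJ; apply: eq_kappa => u.
exact: ins_raddf.
Qed.

Lemma ins_cup (h : S -> S) (g : {additive S -> S}) v f s :
  ins v (fun u => if u is a :: u' then h a * g (f u') : S else 0 : twM rho) s
    = (h v * g (f s) : twM rho)
      - (if s is a :: s' then h a * g (ins v f s') else 0 : twM rho).
Proof.
case: s => [|a s] //=; congr (_ - _).
pose ha : {additive S -> S} := (h a) \*o g.
exact: (ins_raddf ha v f s).
Qed.

Lemma kappa_cup (h : S -> S) (g : {additive S -> S}) x f J :
  kappa x (fun u => if u is a :: u' then h a * g (f u') : S else 0 : twM rho) J
    = wedge (fun l => h (x l)) (fun J' => g (kappa x f J')) J.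
Proof.
elim: J f => //= l J IHJ f.
rewrite (eq_kappa x _ (ins_cup h g (x l) f)) kappaB.
pose ha : {additive S -> S} := (h (x l)) \*o g.
by rewrite [X in X - _](kappa_raddf ha) (IHJ (ins (x l) f)).
Qed.

End TwistedModule.

Section ListCup.
Variable S : comNzRingType.

(* The iterated cup product of the twisted derivations [p.1] with twists
   [p.2], evaluated on a list of arguments. *)
Fixpoint listcup (D : seq ((S -> S) * {rmorphism S -> S})) (s : seq S) : S :=
  match D, s with
  | [::], [::] => 1
  | p :: D', a :: s' => p.1 a * p.2 (listcup D' s')
  | _, _ => 0
  end.

(** The derivations take constant values on the chosen coordinates and the twists fix constants. So
    the twists drop out, and antisymmetrization leaves the minors of the matrix of values. *)
Lemma kappa_listcup (T K : comNzRingType) (rho : {rmorphism T -> S})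
    (iota : {rmorphism K -> S}) (x : nat -> S) (alpha : S -> S)
    (D0 : (S -> S) * {rmorphism S -> S}) D (rows : seq (nat -> K)) J :
  size D = size rows ->
  (forall i l, (i < size D)%N ->
     (nth D0 D i).1 (alpha (x l))
       = iota (nth (fun=> 0) rows i l)) ->
  (forall i c, (i < size D)%N ->
     (nth D0 D i).2 (iota c) = iota c) ->
  kappa x (fun s => listcup D (map alpha s) : twM rho) J = iota (wedges rows J).
Proof.
elim: D rows J => [|p D IHD] [|r rows] // J => [_ _ _ | [zD] Dx Dc].
  case: J => [|l J] /=; first by rewrite rmorph1.
  pose g (u : seq S) : twM rho := (if u is [::] then 1 else 0 : S).
  pose z (u : seq S) : twM rho := 0 *: 0.
  rewrite rmorph0 (@eq_kappa _ _ _ _ _ z) => [|s].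
    by rewrite kappaZ scale0r.
  rewrite (@eq_ins _ _ _ _ _ g); last by case.
  rewrite /z scaler0; case: s => [|a s] /=; first by rewrite subr0.
  rewrite (@eq_ins _ _ _ _ _ z) => [|u]; last by rewrite /z scaler0.
  by rewrite insZ scale0r subr0.
have IH J' : kappa x (fun s => listcup D (map alpha s) : twM rho) J'
    = iota (wedges rows J').
  apply: IHD => // [i l iD|i c iD]; first exact: (Dx i.+1).
  exact: (Dc i.+1).
rewrite (@eq_kappa _ _ _ _ _ (fun u => if u is a :: u' then
    p.1 (alpha a) * p.2 (listcup D (map alpha u')) : S else 0 : twM rho)); last by case.
rewrite (kappa_cup (fun a => p.1 (alpha a)) p.2) /=.
elim: J (wedges rows) (kappa x _) IH => [|l J IHJ] phi phi' pp /=; first by rewrite rmorph0.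
rewrite rmorphB rmorphM; congr (_ * _ - _).
- exact: (Dx 0%N).
- by rewrite pp; exact: (Dc 0%N).
by apply: (IHJ (fun u => phi (l :: u)) (fun u => phi' (l :: u))) => u.
Qed.

End ListCup.

Section TwistedCoefficients.
Variables (F : fieldType) (n : nat).
Local Notation S := {mpoly F[n]}.
Variables (alpha beta : {rmorphism S -> S}).
Hypothesis alphaC : forall c, alpha c%:MP = c%:MP.
Hypothesis betaC : forall c, beta c%:MP = c%:MP.

(** Scalars through this map make [S] the bimodule on which [a] acts by [alpha a] from the left and
    by [beta a] from the right. *)
Definition tw_ev (t : envel F n) : S := mmap beta (fun i => alpha 'X_i) t.

Fact tw_ev_additive : additive tw_ev.
Proof. exact: mmap_is_additive. Qed.

Fact tw_ev_multiplicative : multiplicative tw_ev.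
Proof. exact: mmap_is_multiplicative. Qed.

HB.instance Definition _ := GRing.isAdditive.Build _ _ tw_ev tw_ev_additive.
HB.instance Definition _ :=
  GRing.isMultiplicative.Build _ _ tw_ev tw_ev_multiplicative.

Lemma tw_ev_right a : tw_ev (rightT a) = beta a.
Proof. exact: mmapC. Qed.

Lemma tw_ev_leftX i : tw_ev (leftX F i) = alpha 'X_i.
Proof. by rewrite /tw_ev mmapX mmap1U. Qed.

Lemma tw_ev_stair0 a : tw_ev (stair 0 a) = alpha a.
Proof.
apply: (@mpoly_rmorph_ext _ _ _ (tw_ev \o stair 0) alpha) => [c|i] /=.
  by rewrite stairC constT.unlock tw_ev_right betaC alphaC.
by rewrite stairX tw_ev_leftX.
Qed.

Lemma tw_ev_stair_last a : tw_ev (stair n a) = beta a.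
Proof. by rewrite stair_last tw_ev_right. Qed.

Lemma tw_ev_constT c : tw_ev (constT n c) = c%:MP.
Proof. by rewrite constT.unlock tw_ev_right betaC. Qed.

Lemma tw_ev_xdiff l : tw_ev (xdiff F n l) = alpha (xvar n F l) - beta (xvar n F l).
Proof. by rewrite -xdiff_stair rmorphB /= tw_ev_stair0 tw_ev_stair_last. Qed.

End TwistedCoefficients.

(** * The comparison for polynomials twisted by an automorphism *)

Section PolynomialCochains.
Variables (F : fieldType) (n : nat).
Local Notation S := {mpoly F[n]}.
Implicit Types (f w : seq S -> S^o).

Definition polylin p f := multilin (fun c : F => c%:MP_[n]) p f.

Definition twdiff (gamma : S -> S) f s : S^o := bdiff idfun gamma f s.

(** The condition on [phi] says that it is a Koszul 1-cocycle. Its image under [stairmap] is a bar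
    1-cocycle, and the cocycle identity is the twisted Leibniz rule. *)
Lemma twisted_derivation (gamma : {rmorphism S -> S}) (phi : nat -> S) :
  (forall c, gamma c%:MP = c%:MP) ->
  (forall l m, (l < n)%N -> (m < n)%N ->
     (xvar n F l - gamma (xvar n F l)) * phi m
       = (xvar n F m - gamma (xvar n F m)) * phi l) ->
  exists h : S -> S,
    [/\ forall c a b, h (c *: a + b) = c *: h a + h b,
        forall a b, h (a * b) = a * h b + h a * gamma b
      & forall l, (l < n)%N -> h (xvar n F l) = phi l].
Proof.
move=> gammaC phiC.
pose rho : {rmorphism envel F n -> S} := tw_ev idfun gamma.
pose hat (J : seq nat) : twM rho := if J is [:: l] then phi l else 0.
pose h (a : S) : S := stairmap 0 hat [:: a].
have rho0 a : rho (stair 0 a) = a by exact: tw_ev_stair0.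
have rho1 a : rho (stair n a) = gamma a by exact: tw_ev_stair_last.
have rhoC c : rho (constT n c) = c%:MP by exact: tw_ev_constT.
have rhoX l : rho (xdiff F n l) = xvar n F l - gamma (xvar n F l).
  exact: tw_ev_xdiff.
exists h; split=> [c a b|a b|l ln].
- have [lin _] := multilin_stairmap 0 1 hat.
  rewrite /h lin // twME.
  by rewrite rhoC mul_mpolyC.
- have : hdiffT (stairmap 0 hat) [:: a; b] = 0.
    rewrite /hdiffT bdiff_stairmap // (eq_stairmap (psi := fun _ => 0 *: 0)) => [|J iJ].
      by rewrite stairmapZ scale0r.
    case: J iJ => [|l [|m [|? ?]]] // iJ _.
    rewrite /= subr0 scaler0 !twME !rhoX.
    case/andP: iJ => _ /= /and3P[ln mn _].
    by rewrite phiC // subrr.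
  rewrite /hdiffT /bdiff /bmul !twME rho0 rho1 opprB => /eqP.
  rewrite addrA subr_eq0 => /eqP E; rewrite [LHS](esym E).
  by rewrite [h a * _]mulrC.
rewrite /h /= (eq_big_nat _ _ (F2 := fun j => if j == l then phi l else 0)) => [|j /andP[_ jn]].
  by rewrite -big_mkcond big_nat1_eq ln.
rewrite twME deltaX //.
rewrite rmorph_nat; case: eqP => [->|_]; last by rewrite mul0r.
exact: mul1r.
Qed.

Lemma kosz_twM (T : comNzRingType) (rho : {rmorphism T -> S}) (e : nat -> S)
    (e' : nat -> T) (psi : seq nat -> S) J :
  (forall l, e l = rho (e' l)) ->
  kosz e (psi : seq nat -> S^o) J = kosz e' (psi : seq nat -> twM rho) J.
Proof.
by move=> ee; elim: J psi => //= l J IHJ psi; rewrite IHJ twME ee.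
Qed.

Lemma kappa_twM (T : comNzRingType) (rho : {rmorphism T -> S}) x
    (f : seq S -> S) J :
  kappa x (f : seq S -> S^o) J = kappa x (f : seq S -> twM rho) J.
Proof.
have insE v g s : ins v (g : seq S -> S^o) s = ins v (g : seq S -> twM rho) s.
  by elim: s g => //= a s IHs g; rewrite IHs.
elim: J f => //= l J IHJ f; rewrite -IHJ; exact: eq_kappa.
Qed.

(* Restating the comparison theorem for the coefficients twisted by [gamma], in
   the coordinates provided by an automorphism [alpha]. *)
Lemma twdiff_coboundary p (alpha alpha' gamma : {rmorphism S -> S}) f
    (psi : seq nat -> S^o) :
  (forall c, alpha c%:MP = c%:MP) -> (forall c, alpha' c%:MP = c%:MP) ->
  (forall c, gamma c%:MP = c%:MP) ->
  cancel alpha alpha' -> cancel alpha' alpha ->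
  polylin p.+1 f ->
  (forall s, size s = p.+2 -> twdiff gamma f s = 0) ->
  (forall J, indexset 0 n J -> size J = p.+1 ->
     kappa (xvar n F) (fun s => f (map alpha s)) J
       = kosz (fun l => alpha (xvar n F l) - gamma (alpha (xvar n F l))) psi J) ->
  exists2 w, polylin p w
    & forall s, size s = p.+1 -> f s = twdiff gamma w s.
Proof.
move=> alphaC alpha'C gammaC aK a'K fp df kf.
pose beta : {rmorphism S -> S} := gamma \o alpha.
have betaC c : beta c%:MP = c%:MP by rewrite /= alphaC gammaC.
pose rho : {rmorphism envel F n -> S} := tw_ev alpha beta.
have rho0 a : rho (stair 0 a) = alpha a by exact: tw_ev_stair0.
have rho1 a : rho (stair n a) = gamma (alpha a) by exact: tw_ev_stair_last.
have rhoC c : rho (constT n c) = c%:MP by exact: tw_ev_constT.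
pose tw (g : seq S -> S^o) (s : seq S) : twM rho := g (map alpha s).
have bmul_tw g a s : bmul (@stair F n n) (tw g) a s = bmul gamma g (alpha a) (map alpha s).
  elim: s a g => [|b s IHs] a g /=; first by rewrite twME rho1.
  by rewrite -(IHs b (fun u => g (alpha a :: u))) /tw /= rmorphM.
have hdiff_tw g s : hdiffT (tw g) s = twdiff gamma g (map alpha s).
  case: s => [|a s] //; rewrite /hdiffT /twdiff /= twME rho0 -bmul_tw.
  by [].
have alphaZ c a : alpha (c *: a) = c *: alpha a.
  by rewrite -mul_mpolyC rmorphM alphaC mul_mpolyC.
have alpha'Z c a : alpha' (c *: a) = c *: alpha' a.
  by rewrite -mul_mpolyC rmorphM alpha'C mul_mpolyC.
have tw_lin q g : polylin q g -> multilin (@constT F n) q (tw g).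
  elim: q g => //= q IHq g [g1 g2]; split=> [s sz c a b|a].
    rewrite /tw /= rmorphD alphaZ g1 ?size_map // -rhoC.
    reflexivity.
  exact: (IHq (fun s => g (alpha a :: s)) (g2 (alpha a))).
have tw_lin' q (g : seq S -> twM rho) : multilin (@constT F n) q g ->
    polylin q (fun s => g (map alpha' s)).
  elim: q g => //= q IHq g [g1 g2]; split=> [s sz c a b|a].
    rewrite /= rmorphD alpha'Z g1 ?size_map // -rhoC.
    reflexivity.
  exact: (IHq (fun s => g (alpha' a :: s)) (g2 (alpha' a))).
have [||||w wp Ew] := @theta_coboundary F n p.+1 (twM rho) (fun m => m = 0) (tw f).
- by [].
- by move=> t m m' -> ->; rewrite scaler0 addr0.
- exact: tw_lin.
- by move=> s zs; rewrite hdiff_tw df // size_map.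
(* The cochain [f] is [stairmap] of its antisymmetrization plus d [w]; as that antisymmetrization is
   the Koszul differential of [psi], the first part is d of [stairmap] of [psi]. *)
pose W s := stairmap 0 (psi : seq nat -> twM rho) s + w s.
have Wp : multilin (@constT F n) p W.
  have := multilinDZ 1 (multilin_stairmap 0 p (psi : seq nat -> twM rho)) wp.
  by apply: eq_multilin => s _; rewrite scale1r.
exists (fun s => W (map alpha' s)); first exact: tw_lin'.
move=> s zs.
have E u : size u = p.+1 -> tw f u = hdiffT W u.
  move=> zu; have /eqP := Ew u zu; rewrite /theta subr_eq0 subr_eq => /eqP ->.
  have -> : hdiffT W u = stairmap 0 (kosz (xdiff F n) (psi : seq nat -> twM rho)) u
      + hdiffT w u.
    rewrite -bdiff_stairmap // -[X in X + _]scale1r -bdiffDZ.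
    by apply: eq_bdiff => v; rewrite scale1r.
  rewrite addrC; congr (_ + _); apply: eq_stairmap => J iJ zJ.
  rewrite zu in zJ.
  rewrite -[LHS](kappa_twM rho) [LHS](kf J iJ zJ); apply: kosz_twM => l; rewrite -[RHS]/(rho _).
  exact/esym/tw_ev_xdiff.
have -> : f s = tw f (map alpha' s) by rewrite /tw mapK.
rewrite E ?size_map //.
transitivity (hdiffT (tw (fun s => W (map alpha' s))) (map alpha' s)).
  rewrite /hdiffT; apply: (@eq_bdiff _ _ (twM rho)) => u.
  by rewrite /tw mapK.
by rewrite hdiff_tw mapK.
Qed.

End PolynomialCochains.

(** * The linear action and factorizations into reflections *)

Section Action.
Variable n : nat.
Implicit Types (g h A : mat n) (p q : SV n).

Fact act_additive g : additive (act g).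
Proof. by move=> p q; exact: comp_mpolyB. Qed.

Fact act_multiplicative g : multiplicative (act g).
Proof. exact: comp_mpoly_is_multiplicative. Qed.

HB.instance Definition _ g := GRing.isAdditive.Build _ _ (act g) (act_additive g).
HB.instance Definition _ g :=
  GRing.isMultiplicative.Build _ _ (act g) (act_multiplicative g).

Definition linform (v : 'cV[CC]_n) : SV n := \sum_(i < n) v i 0 *: 'X_i.

Lemma actC g c : act g c%:MP = c%:MP.
Proof. exact: comp_mpolyC. Qed.

Lemma actZ g c p : act g (c *: p) = c *: act g p.
Proof. exact: comp_mpolyZ. Qed.

Lemma actX g (j : 'I_n) : act g 'X_j = linform (col j g).
Proof.
rewrite /act comp_mpolyXU -tnth_nth tnth_mktuple.
by apply: eq_bigr => i _; rewrite mxE.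
Qed.

Lemma linformD u v : linform (u + v) = linform u + linform v.
Proof. by rewrite -big_split; apply: eq_bigr => i _; rewrite mxE scalerDl. Qed.

Lemma linformZ c u : linform (c *: u) = c *: linform u.
Proof. by rewrite scaler_sumr; apply: eq_bigr => i _; rewrite mxE scalerA. Qed.

Lemma linformB u v : linform (u - v) = linform u - linform v.
Proof. by rewrite linformD -scaleN1r linformZ scaleN1r. Qed.

Lemma act_act g h p : act g (act h p) = act (g *m h) p.
Proof.
apply: (@mpoly_rmorph_ext _ _ _ (act g \o act h) (act (g *m h))) => [c|j] /=.
  by rewrite !actC.
rewrite !actX /linform rmorph_sum /=.
under eq_bigr do rewrite actZ actX scaler_sumr.
rewrite exchange_big; apply: eq_bigr => i _ /=.
rewrite !mxE scaler_suml; apply: eq_bigr => k _.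
by rewrite !mxE scalerA mulrC.
Qed.

Lemma act1 p : act 1%:M p = p.
Proof.
apply: (@mpoly_rmorph_ext _ _ _ (act 1%:M) idfun) => [c|j] /=; first exact: actC.
rewrite actX /linform (bigD1 j) //= !mxE eqxx scale1r big1 ?addr0 // => i ij.
by rewrite !mxE (negbTE ij) scale0r.
Qed.

Lemma act_xvar g l (ln : (l < n)%N) :
  act g (xvar n CC l) = linform (col (Ordinal ln) g).
Proof. by rewrite -actX -[l in LHS]/(val (Ordinal ln)) xvarE. Qed.

End Action.

Lemma reflection_rank1 n (r : mat n) : is_reflection r ->
  exists (u : 'cV[CC]_n) (lam : 'rV[CC]_n), r - 1%:M = u *m lam.
Proof.
case=> _ [r1]; rewrite /fixed_space mxrank_ker => rk.
(* [n.-1] truncates at [n = 0], where however [r != 1] is impossible. *)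
have n0 : (0 < n)%N.
  case: n r r1 {rk} => // r /eqP[]; apply/matrixP => -[] //.
have : \rank (r - 1%:M) = 1%N.
  have -> : r - 1%:M = (r^T - 1%:M)^T by rewrite linearB /= trmxK trmx1.
  rewrite mxrank_tr; have := rank_leq_row (r^T - 1%:M); lia.
rewrite -{2}(mulmx_base (r - 1%:M)).
move: (col_base _) (row_base _); case: (\rank _) => [|[|m]] // u lam _.
by exists u, lam.
Qed.

Section GaussData.
Variable n : nat.

(** By 1 - r k = (1 - r) + r (1 - k): passing a factor changes the column vectors but not the
    functionals. *)
Lemma reflection_product_sub1 (s : seq (mat n)) (Lam : seq 'rV[CC]_n) :
  size Lam = size s ->
  (forall i, (i < size s)%N ->
     exists u : 'cV[CC]_n, nth 0 s i - 1%:M = u *m nth 0 Lam i) ->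
  exists Q : seq 'cV[CC]_n,
    1%:M - foldr (fun r acc => r *m acc) 1%:M s
      = \sum_(i < size s) nth 0 Q i *m nth 0 Lam i.
Proof.
elim: s Lam => [|r s IHs] [|lam Lam] //= zL sL.
  by exists [::]; rewrite subrr big_ord0.
case: zL => zL; have [//|i /(sL i.+1) //|Q EQ] := IHs Lam.
have [/= u Eu] := sL 0%N isT.
exists (- u :: map (mulmx r) Q).
rewrite big_ord_recl /= mulNmx -Eu.
rewrite (eq_bigr (fun i : 'I_(size s) => r *m (nth 0 Q i *m nth 0 Lam i))) => [|i _].
  by rewrite -mulmx_sumr -EQ mulmxBr mulmx1 opprB addrA addrNK.
rewrite mulmxA; congr (_ *m _); rewrite /bump /= add0n.
case: (ltnP i (size Q)) => iQ; first by rewrite (nth_map 0).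
by rewrite !nth_default ?size_map // mulmx0.
Qed.

(** [P i] is the functional of the i-th reflection in the coordinates [A], which bring 1 - k to the
    form [L *m pid_mx d]. A sum of [d] rank-one terms that has rank [d] forces its functionals to
    form a basis of the row space; in these coordinates they live in the first [d] entries and form
    an invertible block. *)
Lemma gauss_data (k : mat n) (s : seq (mat n)) :
  (forall r, r \in s -> is_reflection r) ->
  k = foldr (fun r acc => r *m acc) 1%:M s -> size s = codim_fixed k ->
  exists (A A' L L' : mat n) (P : nat -> 'rV[CC]_n), let d := size s in
    [/\ A *m A' = 1%:M /\ A' *m A = 1%:M, L *m L' = 1%:M /\ L' *m L = 1%:M,
        (d <= n)%N /\ (1%:M - k) *m A = L *m pid_mx d,
        forall i, (i < d)%N -> exists u lam, nth 0 s i - 1%:M = u *m lam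
            /\ lam *m A = P i
      & (forall i (l : 'I_n), (i < d)%N -> (d <= l)%N -> P i 0 l = 0)
        /\ \det (\matrix_(i < d, j < d)
             (if insub (val j) is Some j' then P i 0 (j' : 'I_n) else 0)) != 0].
Proof.
move=> refl_s Ek zs.
have rkN : \rank (1%:M - k) = size s.
  rewrite zs /codim_fixed /fixed_space mxrank_ker.
  have -> : 1%:M - k = - (k^T - 1%:M)^T.
    by rewrite linearB /= trmxK trmx1 opprB.
  rewrite -scaleN1r mxrank_scale_nz ?oppr_eq0 ?oner_eq0 // mxrank_tr.
  by have := rank_leq_row (k^T - 1%:M); lia.
set d := size s.
have dn : (d <= n)%N by rewrite /d -rkN rank_leq_row.
have /choice[Lam ELam] (r : mat n) : exists lam : 'rV[CC]_n, is_reflection r ->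
    exists u : 'cV[CC]_n, r - 1%:M = u *m lam.
  have [/reflection_rank1[u [lam E]]|] := EM (is_reflection r); last by exists 0.
  by exists lam => _; exists u.
pose LamS := map Lam s.
have nthLam i : (i < d)%N -> nth 0 LamS i = Lam (nth 0 s i).
  by move=> id; rewrite (nth_map 0).
have reflS i : (i < d)%N ->
    exists u : 'cV[CC]_n, nth 0 s i - 1%:M = u *m nth 0 LamS i.
  by move=> id; rewrite nthLam //; apply/ELam/refl_s/mem_nth.
have [|Q EQ] := @reflection_product_sub1 s LamS _ reflS; first by rewrite size_map.
pose N := 1%:M - k; pose L := col_ebase N; pose U := row_ebase N.
pose A := invmx U; pose L' := invmx L.
have UA : U *m A = 1%:M by rewrite mulmxV // row_ebase_unit.
have AU : A *m U = 1%:M by rewrite mulVmx // row_ebase_unit.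
have LL' : L *m L' = 1%:M by rewrite mulmxV // col_ebase_unit.
have L'L : L' *m L = 1%:M by rewrite mulVmx // col_ebase_unit.
have NA : N *m A = L *m pid_mx d.
  by rewrite -[X in X *m A](mulmx_ebase N) -(mulmxA _ U A) UA mulmx1 rkN.
pose P (i : nat) := nth 0 LamS i *m A.
pose Pm : 'M[CC]_(d, n) := \matrix_(i, j) P i 0 j.
pose Qm : 'M[CC]_(n, d) := \matrix_(i, j) nth 0 Q j i 0.
have QP : Qm *m Pm = L *m pid_mx d.
  rewrite -NA /N Ek EQ mulmx_suml; apply/matrixP => i j.
  rewrite mxE summxE; apply: eq_bigr => l _.
  by rewrite -mulmxA -/(P l) [RHS]mxE big_ord1 /Qm /Pm !(mxE matrix_key).
(* A left inverse of the leading block [R] of [Pm]; both are square, so it is two-sided, and [Pm] is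
   [R] followed by zero columns. *)
pose Q' : 'M[CC]_d := pid_mx d *m (L' *m Qm).
have Q'P : Q' *m Pm = pid_mx d.
  rewrite /Q' -!mulmxA QP (mulmxA L') L'L mul1mx mul_pid_mx.
  by congr pid_mx; move: dn; lia.
pose R : 'M[CC]_d := Pm *m pid_mx d.
have Q'R : Q' *m R = 1%:M.
  by rewrite mulmxA Q'P mul_pid_mx minnn (minn_idPr dn) pid_mx_1.
have RQ' : R *m Q' = 1%:M by exact: mulmx1C.
have PE : Pm = R *m pid_mx d by rewrite -Q'P mulmxA RQ' mul1mx.
exists A, U, L, L', P; split=> //.
- by move=> i /reflS[u Eu]; exists u, (nth 0 LamS i).
split=> [i l id dl|].
  have <- : Pm (Ordinal id) l = P i 0 l by rewrite /Pm [LHS]mxE.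
  rewrite PE mxE big1 // => j _; rewrite !mxE.
  rewrite (_ : (j == l :> nat) = false) ?mulr0 //.
  by apply/negbTE; rewrite neq_ltn (leq_trans (ltn_ord j) dl).
have -> : \matrix_(i < d, j < d)
    (if insub (val j) is Some j' then P i 0 (j' : 'I_n) else 0) = R.
  apply/matrixP => i j; rewrite [LHS]mxE [RHS]mxE.
  have jn : (j < n)%N := leq_trans (ltn_ord j) dn.
  rewrite insubT (bigD1 (Ordinal jn)) //= [pid_mx _ _ _]mxE /= eqxx ltn_ord mulr1.
  rewrite /Pm [X in _ = X + _]mxE.
  rewrite big1 ?addr0 // => l; rewrite -val_eqE /= => /negbTE lj.
  by rewrite [pid_mx _ _ _]mxE lj mulr0.
rewrite -unitfE -unitmxE; apply/(mulmx1_unit RQ').1.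
Qed.

End GaussData.

(* The evaluation killing the first [i] variables. *)
HB.lock Definition kill (n i : nat) : SV n -> SV n :=
  mmap (@mpolyC n CC) (fun l : 'I_n => if (l < i)%N then 0 else 'X_l).

(** * The Koszul complex of independent linear forms *)

Section KoszulPolynomial.
Variables (n d : nat) (L L' : mat n) (e : nat -> SV n).
Hypotheses (LL' : L *m L' = 1%:M) (L'L : L' *m L = 1%:M) (dn : (d <= n)%N).
Hypothesis eE : forall l, (l < d)%N -> e l = act L (xvar n CC l).
Hypothesis e0 : forall l, (d <= l)%N -> e l = 0.
Local Notation kill := (@kill n).

Fact kill_additive i : additive (kill i).
Proof. by rewrite kill.unlock; exact: mmap_is_additive. Qed.

Fact kill_multiplicative i : multiplicative (kill i).
Proof. by rewrite kill.unlock; exact: mmap_is_multiplicative. Qed.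

HB.instance Definition _ i :=
  GRing.isAdditive.Build _ _ (kill i) (kill_additive i).
HB.instance Definition _ i :=
  GRing.isMultiplicative.Build _ _ (kill i) (kill_multiplicative i).

Lemma killC i c : kill i c%:MP = c%:MP.
Proof. by rewrite kill.unlock mmapC. Qed.

Lemma killX i (l : 'I_n) : kill i 'X_l = if (l < i)%N then 0 else 'X_l.
Proof. by rewrite kill.unlock mmapX mmap1U. Qed.

Lemma killD i p q : kill i (p + q) = kill i p + kill i q.
Proof. exact: rmorphD. Qed.

Lemma killM i p q : kill i (p * q) = kill i p * kill i q.
Proof. exact: rmorphM. Qed.

Lemma kill0 m : kill 0 m = m.
Proof.
by apply: (@mpoly_rmorph_ext _ _ _ (kill 0) idfun) => [c|l] /=; rewrite ?killC ?killX.
Qed.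

Lemma kill_kill i j m : (i <= j)%N -> kill j (kill i m) = kill j m.
Proof.
move=> ij; apply: (@mpoly_rmorph_ext _ _ _ (kill j \o kill i) (kill j)) => [c|l] /=.
  by rewrite !killC.
rewrite !killX; case: ifP => li; last by rewrite killX.
by rewrite rmorph0 (leq_trans li).
Qed.

(** For [i <= d], the ideal of [e 0], ..., [e i.-1]: in the coordinates [L'] these are the first [i]
    variables. As the kernel of a morphism into a domain it is prime, which yields regularity. *)
Let I i (m : (SV n)^o) : Prop := kill i (act L' m) = 0.

Lemma kosz_exact p (phi : seq nat -> (SV n)^o) :
  (forall J, indexset 0 n J -> size J = p.+1 -> kosz e phi J = 0) ->
  exists psi sigma : seq nat -> (SV n)^o,
    (forall J, indexset 0 n J -> size J = p -> phi J = kosz e psi J + sigma J)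
    /\ forall J, ~~ all (mem J) (iota 0 d) -> sigma J = 0.
Proof.
move=> cphi.
have actK m : act L' (act L m) = m by rewrite act_act L'L act1.
have actK' m : act L (act L' m) = m by rewrite act_act LL' act1.
have L'e i m (id : (i < d)%N) : act L' (e i * m)
    = 'X_(Ordinal (leq_trans id dn)) * act L' m.
  by rewrite rmorphM /= eE // actK -[i in xvar _ _ i]/(val (Ordinal (leq_trans id dn))) xvarE.
have I0P m : I 0 m -> m = 0.
  by rewrite /I kill0 => E; rewrite -[m]actK' E rmorph0.
have [||||||||psi [sigma [E Z]]] := @kosz_exact_from (SV n) (SV n)^o e d n I dn
    _ _ _ _ _ _ e0 d 0 p phi.
- by move=> i; rewrite /I !rmorph0.
- move=> i t m m'; rewrite /I => hm hm'.
  have -> : act L' (t *: m + m') = act L' t * act L' m + act L' m'.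
    by rewrite [LHS]rmorphD; congr (_ + _); exact: rmorphM.
  have aux (x y z : SV n) : y = 0 -> z = 0 -> x * y + z = 0.
    by move=> -> ->; rewrite mulr0 addr0.
  by rewrite killD killM; exact: aux.
- move=> i m id; rewrite /I L'e killM killX ltnn => /mpoly_mul_eq0[] //.
  by move/(congr1 (fun q : SV n => q@_(U_(Ordinal (leq_trans id dn)))));
    rewrite mcoeffX eqxx mcoeff0 => /eqP; rewrite oner_eq0.
- move=> i m id; rewrite /I => E; rewrite -(kill_kill _ (leqnSn i)) E.
  exact: rmorph0.
- move=> i m id; by rewrite /I L'e killM killX /= leqnn mul0r.
- move=> i m id; rewrite /I => E; pose j := Ordinal (leq_trans id dn).
  have [||q Eq] := @mpoly_rmorph_dvd _ _ _ (kill i) (kill i.+1) j (act L' m).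
  + by move=> c; rewrite /= !killC.
  + move=> l lj; rewrite /= !killX [(l < i.+1)%N]ltnS [(l <= i)%N]leq_eqVlt.
    by rewrite (_ : (l == i :> nat) = false) //; exact: negbTE.
  exists (act L q); rewrite /I.
  have -> : act L' (m - e i *: (act L q : (SV n)^o)) = act L' m - 'X_j * q.
    rewrite [LHS]rmorphB; congr (_ - _); apply: etrans (L'e _ _ id) _.
    by rewrite actK.
  move: Eq; rewrite /= E subr0 !killX ltnn ltnS leqnn subr0 => Eq.
  have -> : kill i (act L' m - 'X_j * q) = kill i (act L' m) - kill i ('X_j * q).
    exact: rmorphB.
  by rewrite -[in X in X - _](kill_kill _ (leqnn i)) Eq subrr.
- by rewrite add0n.
- by move=> J iJ zJ; rewrite cphi // /I !rmorph0.
exists psi, sigma; split=> // J iJ zJ.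
by apply/eqP; rewrite -subr_eq0 opprD addrA; apply/eqP/I0P/E.
Qed.

End KoszulPolynomial.

(** * Twisted derivations and their cup products *)

Section Derivations.
Variable n : nat.
Local Notation S := (SV n).

Definition twder (p : (S -> S) * mat n) : Prop :=
  (forall c a b, p.1 (c *: a + b) = c *: p.1 a + p.1 b)
  /\ forall a b, p.1 (a * b) = a * p.1 b + p.1 a * act p.2 b.

(** For nonzero [u] this is the divided difference (r a - a) / [linform u]; for [u = 0] it is the
    ordinary derivative along [lam]. Both satisfy the condition of [twisted_derivation], as x_l - r
    x_l = - lam_l [linform u]. *)
Lemma twder_of_rank1 (r : mat n) (u : 'cV[CC]_n) (lam : 'rV[CC]_n) :
  r - 1%:M = u *m lam ->
  exists h : S -> S, twder (h, r)
    /\ forall v : 'cV[CC]_n, h (linform v) = ((lam *m v) 0 0)%:MP.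
Proof.
move=> Er.
pose phi l : S := if insub l is Some l' then (lam 0 (l' : 'I_n))%:MP else 0.
have E l (ln : (l < n)%N) : xvar n CC l - act r (xvar n CC l)
    = - (phi l * linform u).
  rewrite -[X in X - _]act1 !act_xvar -linformB /phi insubT.
  have -> c : - (c%:MP * linform u) = linform (- (c *: u)).
    by rewrite mul_mpolyC -(scaleN1r (c *: u)) !linformZ scaleN1r.
  congr linform.
  have -> : col (Ordinal ln) 1%:M - col (Ordinal ln) r
      = - col (Ordinal ln) (r - 1%:M).
    by rewrite linearB /= opprB.
  by rewrite Er; apply/colP => i; rewrite !mxE big_ord1 mulrC.
have [|l m ln mn|h [hL hM hX]] := @twisted_derivation CC n (act r) phi.
- exact: actC.
- by rewrite !E //; ring.
exists h; split=> [|v]; first by split.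
have h0 : h 0 = 0.
  by have := hL (-1) 0 0; rewrite scaler0 addr0 scaleN1r addNr.
have hD a b : h (a + b) = h a + h b by rewrite -[a]scale1r hL !scale1r.
have hZ c a : h (c *: a) = c *: h a by rewrite -[c *: a]addr0 hL h0 addr0.
rewrite /linform (big_morph h hD h0) mxE rmorph_sum; apply: eq_bigr => i _ /=.
rewrite hZ -xvarE hX // /phi valK -mul_mpolyC -rmorphM /=.
by rewrite mulrC.
Qed.

Definition cupder (E : seq ((S -> S) * mat n)) : seq S -> S^o :=
  listcup [seq (p.1, act p.2 : {rmorphism S -> S}) | p <- E].

Definition mxprod (E : seq ((S -> S) * mat n)) : mat n :=
  foldr (fun p acc => p.2 *m acc) 1%:M E.

Definition twders (E : seq ((S -> S) * mat n)) : Prop :=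
  forall i, (i < size E)%N -> twder (nth (fun=> 0, 1%:M) E i).

Lemma twders_cons p E : twders (p :: E) -> twder p /\ twders E.
Proof. by move=> H; split=> [|i iE]; [exact: (H 0%N) | exact: (H i.+1)]. Qed.

Lemma cupder_polylin E : twders E -> polylin (size E) (cupder E).
Proof.
elim: E => //= p E IHE /twders_cons[[pL _] /IHE Ep]; split=> [s sz c a b|a].
  rewrite /cupder /= pL -[RHS]/(c%:MP * (p.1 a * _) + p.1 b * _ : S).
  by rewrite mulrDl -mul_mpolyC mulrA.
suff aux (q : nat) (F : seq S -> S^o) : polylin q F ->
    polylin q (fun s => (p.1 a * act p.2 (F s) : S)).
  exact: (aux _ _ Ep).
elim: q F => //= q IHq F [F1 F2]; split=> [s sz c x y|x]; last exact: (IHq _ (F2 x)).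
have actL (u v : S) : act p.2 (c%:MP * u + v) = c%:MP * act p.2 u + act p.2 v.
  by rewrite rmorphD rmorphM /= actC.
rewrite F1 //; apply: etrans (congr1 _ (actL _ _)) _.
by rewrite mulrDr mulrCA.
Qed.

(** The Leibniz rule splits the first merge in two: one half cancels the left action, and the other
    is absorbed by the cocycle identity of the tail, twisted by the head. *)
Lemma cupder_cocycle E s : twders E -> size s = (size E).+1 ->
  twdiff (act (mxprod E)) (cupder E) s = 0.
Proof.
elim: E s => [|p E IHE] s.
  case: s => [|a [|b s]] // _ _; rewrite /twdiff /= act1.
  exact: subrr.
move=> /twders_cons[[pL pM] dE]; case: s => [|a [|b s]] // [zs].
have actB (u v : S) : act p.2 (u - v) = act p.2 u - act p.2 v by exact: rmorphB.
have actM (u v : S) : act p.2 (u * v) = act p.2 u * act p.2 v by exact: rmorphM.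
have aux F x u : bmul (act (p.2 *m mxprod E)) (fun v => (p.1 a * act p.2 (F v) : S^o)) x u
    = (p.1 a * act p.2 (bmul (act (mxprod E)) (F : seq S -> S^o) x u) : S).
  elim: u x F => [|y u IHu] x F.
    transitivity (p.1 a * (act (p.2 *m mxprod E) x * act p.2 (F [::]))).
      exact: mulrCA.
    by rewrite -act_act -actM.
  transitivity (p.1 a * act p.2 (F (x * y :: u)) - p.1 a
      * act p.2 (bmul (act (mxprod E)) (fun v => F (x :: v) : S^o) y u)).
    by congr (_ - _); exact: (IHu y (fun v => F (x :: v))).
  by rewrite -mulrBr -actB.
have Z : p.1 a * act p.2 (twdiff (act (mxprod E)) (cupder E) (b :: s)) = 0.
  transitivity (p.1 a * act p.2 (0 : S)); first by rewrite (IHE (b :: s) dE) //= zs.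
  by rewrite rmorph0 mulr0.
have EZ : twdiff (act (mxprod E)) (cupder E) (b :: s)
    = b * cupder E s - bmul (act (mxprod E)) (cupder E) b s by [].
rewrite EZ actB actM mulrBr -aux in Z.
transitivity (a * (p.1 b * act p.2 (cupder E s))
  - (p.1 (a * b) * act p.2 (cupder E s)
     - bmul (act (p.2 *m mxprod E)) (fun v => (p.1 a * act p.2 (cupder E v) : S^o)) b s)).
  by [].
have leibniz (R : comNzRingType) (x px y py z w : R) :
    px * (y * z) - w = 0 -> x * (py * z) - ((x * py + px * y) * z - w) = 0.
  by move/eqP; rewrite subr_eq0 => /eqP <-; ring.
by rewrite pM; exact: leibniz Z.
Qed.

End Derivations.

(** * Linear combinations of cochains and enumeration of index sets *)

Section LinearCombinations.
Variables (S T : comNzRingType) (M : lmodType T) (I : Type).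
Variables (t : I -> T) (f : I -> seq S -> M).
Implicit Types (r : seq I).

Lemma bdiff_sum wl wr r s :
  bdiff wl wr (fun u => \sum_(i <- r) t i *: f i u) s
    = \sum_(i <- r) t i *: bdiff wl wr (f i) s.
Proof.
elim: r => [|i r IHr].
  rewrite big_nil; apply: etrans (subrr (bdiff wl wr (fun=> 0) s)).
  by rewrite -bdiffB; apply: eq_bdiff => u; rewrite big_nil subr0.
rewrite big_cons -IHr -bdiffDZ; apply: eq_bdiff => u.
by rewrite big_cons.
Qed.

Lemma kappa_eq0 (g : seq S -> M) x J :
  (forall u, size u = size J -> g u = 0) -> kappa x g J = 0.
Proof.
move=> g0; pose R (m _ : M) := m = 0.
have RDZ (c : T) m u m' u' : R m u -> R m' u' -> R (c *: m + m') (c *: u + u').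
  by rewrite /R => -> ->; rewrite scaler0 addr0.
exact: (@kappa_rel _ _ _ _ R RDZ g g x J g0).
Qed.

Lemma kappa_sum x r J :
  kappa x (fun u => \sum_(i <- r) t i *: f i u) J
    = \sum_(i <- r) t i *: kappa x (f i) J.
Proof.
elim: r => [|i r IHr].
  by rewrite big_nil kappa_eq0 // => u _; rewrite big_nil.
rewrite big_cons -IHr -kappaDZ; apply: eq_kappa => u.
by rewrite big_cons.
Qed.

End LinearCombinations.

Lemma multilin_sum (K : comNzRingType) (S : comAlgType K) (T : comNzRingType)
    (M : lmodType T) (eta : K -> T) (I : eqType) (r : seq I) (t : I -> T)
    (f : I -> seq S -> M) p :
  (forall i, i \in r -> multilin eta p (f i)) ->
  multilin eta p (fun u => \sum_(i <- r) t i *: f i u).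
Proof.
elim: r => [_|i r IHr fr].
  apply: (@eq_multilin _ _ _ _ _ p (fun=> 0)) => [s _|]; first by rewrite big_nil.
  exact: multilin0.
apply: (@eq_multilin _ _ _ _ _ p (fun u => t i *: f i u + \sum_(j <- r) t j *: f j u)).
  by move=> s _; rewrite big_cons.
apply: multilinDZ; first by apply: fr; exact: mem_head.
by apply: IHr => j jr; apply: fr; rewrite inE jr orbT.
Qed.

Lemma bdiff_map (S : comNzRingType) (alpha gamma : {rmorphism S -> S})
    (f : seq S -> S^o) s :
  bdiff alpha (gamma \o alpha) (fun u => f (map alpha u)) s
    = bdiff idfun gamma f (map alpha s).
Proof.
case: s => //= a s; congr (_ - _).
elim: s a f => //= b s IHs a f; rewrite rmorphM.
by rewrite (IHs b (fun u => f (alpha a :: u))).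
Qed.

Lemma indexset_enum d n (P : pred (seq nat)) : (d <= n)%N ->
  exists2 r : seq (seq nat), uniq r
    & forall J, (J \in r) = indexset d n J && P J.
Proof.
move=> dn; pose masks := [seq mask (val m) (iota d (n - d)) | m : (n - d).-tuple bool].
exists (undup [seq J <- masks | indexset d n J && P J]); first exact: undup_uniq.
move=> J; rewrite mem_undup mem_filter; case: (boolP (indexset d n J)) => //= iJ.
rewrite andbC; case: (P J); rewrite (andbF, andbT) //.
have EJ : J = mask [seq l \in J | l <- iota d (n - d)] (iota d (n - d)).
  rewrite -filter_mask; apply: (indexset_perm iJ).
    exact: (sorted_filter ltn_trans _ (iota_ltn_sorted _ _)).
  apply: uniq_perm => [||l]; rewrite ?filter_uniq ?iota_uniq ?(indexset_uniq iJ) //.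
  rewrite mem_filter mem_iota subnKC //; case lJ: (l \in J) => //=.
  by case/andP: iJ => _ /allP /(_ l lJ) ->.
have sz : size [seq l \in J | l <- iota d (n - d)] == (n - d)%N.
  by rewrite size_map size_iota.
by apply/mapP; exists (Tuple sz); rewrite ?mem_enum.
Qed.

Lemma sorted_iota_cat d n J : indexset d n J -> sorted ltn (iota 0 d ++ J).
Proof.
move=> iJ; rewrite (sorted_pairwise ltn_trans) pairwise_cat.
rewrite -!(sorted_pairwise ltn_trans) iota_ltn_sorted.
case/andP: iJ => -> /allP ge_d; rewrite !andbT.
apply/allrelP => x y; rewrite mem_iota => /= xd /ge_d /andP[dy _].
exact: leq_trans dy.
Qed.

Lemma indexset_split d n J : indexset 0 n J -> all (mem J) (iota 0 d) ->
  exists2 J', indexset d n J' & J = iota 0 d ++ J'.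
Proof.
move=> iJ /allP dJ; exists [seq l <- J | d <= l]%N.
  case/andP: iJ => sJ /allP aJ; rewrite /indexset (sorted_filter ltn_trans) //=.
  by apply/allP => l; rewrite mem_filter => /andP[-> /aJ].
have iJ' : indexset d n [seq l <- J | d <= l]%N.
  case/andP: iJ => sJ /allP aJ; rewrite /indexset (sorted_filter ltn_trans) //=.
  by apply/allP => l; rewrite mem_filter => /andP[-> /aJ].
apply: (indexset_perm iJ); first exact: sorted_iota_cat iJ'.
apply: uniq_perm; first exact: indexset_uniq iJ.
  exact: (sorted_uniq ltn_trans ltnn (sorted_iota_cat iJ')).
move=> l; rewrite mem_cat mem_iota mem_filter /= add0n.
by case: ltnP => //= ld; apply: dJ; rewrite mem_iota.
Qed.

(** * Decomposition of a cocycle in one group component *)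

Section Component.
Variable n : nat.
Local Notation S := (SV n).

(** By [kosz_exact] the antisymmetrization of [F] is a Koszul coboundary plus some [sigma] supported
    on the index sets that contain 0, ..., d-1. The products [cupder (E J)] antisymmetrize to
    multiples of the indicators of these sets, so a combination of them matches [sigma], and
    [twdiff_coboundary] applies to the difference. *)
Theorem cocycle_decomposition (k : mat n) (s : seq (mat n)) p (F : seq S -> S^o) :
  (forall r, r \in s -> is_reflection r) ->
  k = foldr (fun r acc => r *m acc) 1%:M s -> size s = codim_fixed k ->
  polylin p.+1 F ->
  (forall u, size u = p.+2 -> twdiff (act k) F u = 0) ->
  exists (r : seq (seq nat)) (coef : seq nat -> S)
      (E : seq nat -> seq ((S -> S) * mat n)),
    (forall J, J \in r ->
       [/\ twders (E J), size (E J) = p.+1, mxprod (E J) = k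
         & all (fun q => q.2 \in 1%:M :: s) (E J)])
    /\ exists2 w, polylin p w & forall u, size u = p.+1 ->
         F u = \sum_(J <- r) (coef J : S) *: cupder (E J) u + twdiff (act k) w u.
Proof.
move=> refl_s Ek zs Fp cF.
have [A [A' [L [L' [P]]]]] := gauss_data refl_s Ek zs.
set d := size s => -[[AA' A'A] [LL' L'L] [dn EA] EP [P0 Pdet]].
pose x := xvar n CC.
(* By [EA] these are the linear forms of the columns of [L] for [l < d], and 0 afterwards. *)
pose e l : S := act A (x l) - act k (act A (x l)).
have linform0 : linform 0 = 0 :> S by rewrite -(scale0r (0 : 'cV[CC]_n)) linformZ scale0r.
have eX l (ln : (l < n)%N) : e l = linform (col (Ordinal ln) (L *m pid_mx d)).
  rewrite /e act_act !act_xvar -linformB -EA; congr linform.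
  by rewrite mulmxBl mul1mx linearB.
have eE l : (l < d)%N -> e l = act L (x l).
  move=> ld; have ln : (l < n)%N by exact: leq_trans dn.
  rewrite (eX l ln) act_xvar; congr linform; apply/colP => i.
  rewrite !mxE (bigD1 (Ordinal ln)) //= !mxE eqxx ld mulr1 big1 ?addr0 // => j.
  by rewrite -val_eqE /= => /negbTE jl; rewrite !mxE jl mulr0.
have e0 l : (d <= l)%N -> e l = 0.
  move=> dl; case: (ltnP l n) => [ln|nl]; last first.
    by rewrite /e /x xvar_out // !rmorph0 subrr.
  rewrite (eX l ln) -linform0; congr linform; apply/colP => i.
  rewrite !mxE big1 // => j _; rewrite !mxE.
  case: eqP => [/= -> | _]; last by rewrite mulr0.
  by rewrite ltnNge dl mulr0.
pose phi := kappa x (fun u => F (map (act A) u)).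
have [|psi [sigma [Ephi Zsigma]]] := kosz_exact LL' L'L dn eE e0 (p := p.+1) (phi := phi).
  move=> J iJ zJ.
  rewrite -(kappa_bdiff (act A) (act k \o act A) x (fun u => F (map (act A) u)) J).
  apply: kappa_eq0 => u zu; rewrite bdiff_map; apply: cF.
  by rewrite size_map zu zJ.
(* Row [j] of [A'] is the j-th coordinate functional for the basis of columns of [A]; [hmu j] is the
   corresponding partial derivative. *)
pose lamM j : 'rV[CC]_n := if insub j is Some j' then row (j' : 'I_n) A' else 0.
have /choice[hmu Hmu] j : exists h, twder (h, 1%:M : mat n)
    /\ forall v, h (linform v) = ((lamM j *m v) 0 0)%:MP.
  by apply: (@twder_of_rank1 _ _ 0); rewrite subrr mul0mx.
have /choice[hh Hh] i : exists h : S -> S, (i < d)%N -> twder (h, nth 0 s i)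
    /\ forall l : 'I_n, h (act A 'X_l) = (P i 0 l)%:MP.
  case: (ltnP i d) => [id|_]; last by exists (fun=> 0).
  have [u [lam [Eu EPi]]] := EP i id.
  have [h [dh Eh]] := twder_of_rank1 Eu.
  exists h => _; split=> // l.
  by rewrite actX Eh -EPi !mxE; congr (_%:MP); apply: eq_bigr => j _; rewrite !mxE.
pose rowd i (l : nat) : CC := if insub l is Some l' then P i 0 (l' : 'I_n) else 0.
pose rowsd := [seq rowd i | i <- iota 0 d].
have zrowsd : size rowsd = d by rewrite size_map size_iota.
have nthrow i : (i < d)%N -> nth (fun=> 0) rowsd i = rowd i.
  by move=> id; rewrite (nth_map 0%N) ?size_iota // nth_iota.
pose c := \det (\matrix_(i < d, j < d) nth (fun=> 0) rowsd i j).
have c0 : c != 0.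
  rewrite (_ : c = \det (\matrix_(i < d, j < d)
      (if insub (val j) is Some j' then P i 0 (j' : 'I_n) else 0))) //.
  by congr (\det _); apply/matrixP => i j; rewrite !mxE nthrow.
(* The untwisted derivations contribute factors 1, and the reflections keep their order in [s], so
   the twists multiply to [k]. *)
pose E J := [seq (hmu j, 1%:M : mat n) | j <- J] ++ [seq (hh i, nth 0 s i) | i <- iota 0 d].
have zE J : size (E J) = (size J + d)%N by rewrite size_cat !size_map size_iota.
have nthE J i : (i < size (E J))%N -> nth (fun=> 0, 1%:M) (E J) i
    = if (i < size J)%N then (hmu (nth 0%N J i), 1%:M)
      else (hh (i - size J)%N, nth 0 s (i - size J)).
  rewrite zE => iE; rewrite nth_cat size_map; case: ltnP => [iJ|Ji].
    by rewrite (nth_map 0%N).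
  have id : (i - size J < d)%N by rewrite ltn_subLR.
  by rewrite (nth_map 0%N) ?nth_iota ?size_iota.
have dE J : twders (E J).
  move=> i iE; rewrite nthE //; case: ltnP => [_|Ji]; first by case: (Hmu (nth 0%N J i)).
  by have [|? _] := Hh (i - size J)%N; first by rewrite ltn_subLR // -zE.
have pE J : mxprod (E J) = k.
  rewrite /mxprod /E foldr_cat foldr_map /= Ek.
  have -> : foldr (fun (q : (S -> S) * mat n) acc => q.2 *m acc) 1%:M
      [seq (hh i, nth 0 s i) | i <- iota 0 d] = foldr (fun r acc => r *m acc) 1%:M s.
    rewrite foldr_map -[in RHS](mkseq_nth 0 s) /mkseq foldr_map.
    by elim: (iota 0 _).
  by elim: J => //= j J IHJ; rewrite mul1mx.
have kE J' J : indexset d n J' -> indexset 0 n J -> size J = (size J' + d)%N ->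
    kappa x (fun u => cupder (E J') (map (act A) u)) J
      = ((-1) ^+ (d * size J') * c * (J == iota 0 d ++ J')%:R)%:MP.
  move=> iJ' iJ zJ; rewrite -(@wedges_dual _ d n rowsd zrowsd) //; last first.
    move=> i l id dl; rewrite nthrow // /rowd; case: insubP => // l' _ El.
    by apply: P0 => //; rewrite El.
  rewrite (@kappa_twM CC n S (act 1%:M) x (fun u => cupder (E J') (map (act A) u))).
  pose one : {rmorphism S -> S} := act 1%:M.
  pose D0 : (S -> S) * {rmorphism S -> S} := (fun=> 0, one).
  pose D := [seq (q.1, act q.2 : {rmorphism S -> S}) | q <- E J'].
  suff H : kappa x (fun u => listcup D (map (act A) u) : twM one) J
      = (wedges ([seq dual_row CC j | j <- J'] ++ rowsd) J)%:MP by exact: H.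
  apply: (@kappa_listcup S S CC one (@mpolyC n CC) x (act A) D0 D).
  - by rewrite size_map zE size_cat size_map zrowsd.
  - move=> i l; rewrite size_map => iE.
    rewrite (nth_map (fun=> 0, 1%:M)) //= nthE // nth_cat size_map.
    have i_d : (size J' <= i)%N -> (i - size J' < d)%N.
      by move=> Ji; rewrite ltn_subLR // -zE.
    have h0 (q : (S -> S) * mat n) : twder q -> q.1 0 = 0.
      by case=> qL _; have := qL (-1) 0 0; rewrite scaler0 addr0 scaleN1r addNr.
    case: (ltnP l n) => [ln|nl]; last first.
      rewrite /x xvar_out // rmorph0; case: ltnP => [iJ0|Ji].
        rewrite (h0 _ (Hmu _).1) (nth_map 0%N) // /dual_row.
        case: eqP => [El|_]; last by rewrite rmorph0.
        have /andP[_ /allP/(_ _ (mem_nth 0%N iJ0))] := iJ'.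
        by rewrite -El ltnNge nl andbF.
      have [dh _] := Hh _ (i_d Ji); rewrite (h0 _ dh) nthrow ?i_d //.
      by rewrite /rowd insubF ?rmorph0 // ltnNge nl.
    rewrite /x -[l in xvar _ _ l]/(val (Ordinal ln)) xvarE.
    case: ltnP => [iJ0|Ji].
      have [_ Hl] := Hmu (nth 0%N J' i); rewrite /= actX Hl (nth_map 0%N) //.
      congr (_%:MP); rewrite /lamM /dual_row.
      have /andP[_ /allP/(_ _ (mem_nth 0%N iJ0)) /andP[_ jn]] := iJ'.
      rewrite insubT; set j' := Sub _ _.
      have -> : (row j' A' *m col (Ordinal ln) A) 0 0 = (A' *m A) j' (Ordinal ln).
        by rewrite !mxE; apply: eq_bigr => m _; rewrite !mxE.
      by rewrite A'A mxE -val_eqE /= eq_sym.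
    have [_ Hl] := Hh _ (i_d Ji); rewrite /= Hl nthrow ?i_d // /rowd insubT.
    by congr (P _ _ _)%:MP; exact: val_inj.
  - move=> i a; rewrite size_map => iE.
    by rewrite (nth_map (fun=> 0, 1%:M)) //= actC.
have [r Ur Er] := indexset_enum (fun J => size J + d == p.+1)%N dn.
(* The required value of [sigma], divided by the nonzero constant of [wedges_dual]. *)
pose coef J : S := (((-1) ^+ (d * size J) * c)^-1)%:MP * sigma (iota 0 d ++ J).
exists r, coef, E; split=> [J|].
  rewrite Er => /andP[iJ /eqP zJ]; split=> //; first by rewrite zE.
  rewrite all_cat; apply/andP; split; apply/allP => q /mapP[j jJ ->] /=; first exact: mem_head.
  by rewrite inE mem_nth ?orbT //; move: jJ; rewrite mem_iota.
pose X u : S^o := \sum_(J <- r) (coef J : S) *: cupder (E J) u.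
have Xp : polylin p.+1 X.
  apply: multilin_sum => J; rewrite Er => /andP[_ /eqP zJ].
  by rewrite -zJ -zE; exact: cupder_polylin.
have XJ J : indexset 0 n J -> size J = p.+1 ->
    kappa x (fun u => X (map (act A) u)) J = sigma J.
  move=> iJ zJ; rewrite (kappa_sum (coef : seq nat -> S)
    (fun J' u => cupder (E J') (map (act A) u))).
  rewrite (eq_big_seq (fun J' => if J == iota 0 d ++ J' then sigma J else 0)) => [|J']; last first.
    rewrite Er => /andP[iJ' /eqP zJ']; rewrite kE // ?zJ ?zJ' //.
    rewrite /coef; case: eqP => [<-|_]; last by rewrite mulr0 rmorph0; exact: mulr0.
    rewrite mulr1 -[LHS]/(_ * _ * _ : S) mulrAC -rmorphM /= mulVf ?rmorph1 ?mul1r //.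
    by rewrite mulf_neq0 // expf_neq0 // oppr_eq0 oner_eq0.
  have [dJ|ndJ] := boolP (all (mem J) (iota 0 d)); last first.
    rewrite big1 ?Zsigma // => J' _; case: eqP => [EJ|//].
    by case/negP: ndJ; apply/allP => l lJ; rewrite EJ /= mem_cat lJ.
  have [J0 iJ0 EJ] := indexset_split iJ dJ.
  have J0r : J0 \in r.
    by rewrite Er iJ0 -zJ EJ size_cat size_iota addnC eqxx.
  rewrite (bigD1_seq J0) //= {1}EJ eqxx big1 ?addr0 // => J' J'0.
  by rewrite {1}EJ eqseq_cat // eqxx /= eq_sym (negbTE J'0).
have [||||||||w wp Ew] := @twdiff_coboundary CC n p (act A) (act A') (act k)
    (fun u => F u - X u) psi.
- exact: actC.
- exact: actC.
- exact: actC.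
- by move=> a; rewrite /= act_act A'A act1.
- by move=> a; rewrite /= act_act AA' act1.
- exact: multilinB.
- move=> u zu; rewrite /twdiff bdiffB [X in X - _]cF // sub0r bdiff_sum.
  rewrite big1_seq ?oppr0 // => J; rewrite Er => /andP[_ /andP[_ /eqP zJ]].
  rewrite -[bdiff _ _ _ _]/(twdiff (act k) (cupder (E J)) u) -(pE J).
  by rewrite cupder_cocycle ?scaler0 // zE zJ.
- move=> J iJ zJ; rewrite kappaB (XJ J iJ zJ) -[X in X - _]/(phi J) Ephi //.
  by rewrite addrK.
exists w => // u zu; rewrite -Ew //.
by rewrite -/(X u) addrC subrK.
Qed.

End Component.

(** * Translation between lists and tuples of arguments *)

Section ListCochains.
Variable n : nat.
Local Notation S := (SV n).

Definition args p (a : 'I_p -> S) : seq S := [seq a i | i <- enum 'I_p].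

Definition component p (f : cochain n p) (k : mat n) (s : seq S) : S^o :=
  f (fun i => nth 0 s i) k.

Lemma size_args p (a : 'I_p -> S) : size (args a) = p.
Proof. by rewrite size_map size_enum_ord. Qed.

Lemma nth_args p (a : 'I_p -> S) (i : 'I_p) : nth 0 (args a) i = a i.
Proof. by rewrite (nth_map i) ?size_enum_ord // nth_ord_enum. Qed.

Lemma component_args p (f : cochain n p) k a : component f k (args a) = f a k.
Proof. by congr (f _ k); apply/funext => i; rewrite nth_args. Qed.

Lemma args_nth p (s : seq S) : size s = p -> args (fun i : 'I_p => nth 0 s i) = s.
Proof.
move=> zs; apply: (@eq_from_nth _ 0) => [|m]; rewrite size_args ?zs // => mp.
by rewrite -[m]/(val (Ordinal mp)) nth_args.
Qed.

Lemma args_cons p (a : 'I_p.+1 -> S) :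
  args a = a ord0 :: args (fun i => a (lift ord0 i)).
Proof. by rewrite /args enum_ordSl /= -map_comp. Qed.

Lemma args0 (a : 'I_0 -> S) : args a = [::].
Proof. by apply: size0nil; rewrite size_args. Qed.

(** Unrolls the recursion into the signed sum over positions that [hdiff] uses. *)
Lemma bmul_args (gamma : S -> S) p (F : seq S -> S^o) (a : 'I_p.+1 -> S) :
  bmul gamma F (a ord0) (args (fun i => a (lift ord0 i)))
    = \sum_(i < p) (-1) ^+ i *: (F (args (Defs.merge a i)) : S)
      + (-1) ^+ p *: (gamma (a ord_max)
          * F (args (fun i => a (widen_ord (leqnSn p) i))) : S).
Proof.
elim: p F a => [|p IHp] F a.
  rewrite big_ord0 add0r expr0 scale1r !args0 /=.
  by congr (gamma (a _) * _); exact: val_inj.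
pose b i := a (lift ord0 i).
have -> : args (fun i => a (lift ord0 i)) = b ord0 :: args (fun i => b (lift ord0 i)).
  exact: (args_cons b).
rewrite big_ord_recl expr0 scale1r -addrA.
transitivity (F (a ord0 * b ord0 :: args (fun i => b (lift ord0 i)))
  - bmul gamma (fun u => F (a ord0 :: u)) (b ord0) (args (fun i => b (lift ord0 i)))).
  by [].
congr (_ + _).
  congr F; rewrite args_cons; congr (_ :: _).
  by congr (a _ * a _); exact: val_inj.
rewrite (IHp (fun u => F (a ord0 :: u)) b) opprD -sumrN; congr (_ + _).
  apply: eq_bigr => i _.
  have -> : args (Defs.merge a (lift ord0 i)) = a ord0 :: args (Defs.merge b i).
    rewrite args_cons; congr (_ :: _); first by congr a; exact: val_inj.
    congr (args _); apply/funext => j; rewrite /Defs.merge /b !lift0 ltnS.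
    rewrite (inj_eq (@lift_inj _ ord0)).
    case: ifP => _; first by congr a; exact: val_inj.
    by case: ifP => _ //; congr (a _ * a _); exact: val_inj.
  by rewrite lift0 exprS mulN1r scaleNr.
have -> : args (fun i : 'I_p.+1 => a (widen_ord (leqnSn p.+1) i))
    = a ord0 :: args (fun i => b (widen_ord (leqnSn p) i)).
  rewrite args_cons; congr (_ :: _); first by congr a; exact: val_inj.
  by congr (args _); apply/funext => j; congr a; exact: val_inj.
have -> : a ord_max = b ord_max by congr a; exact: val_inj.
by rewrite exprS mulN1r scaleNr.
Qed.

Lemma polylin_of p (F : seq S -> S^o) :
  (forall s1 s2 c u v, (size s1 + size s2).+1 = p ->
     F (s1 ++ (c *: u + v) :: s2) = c *: (F (s1 ++ u :: s2) : S) + F (s1 ++ v :: s2)) ->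
  polylin p F.
Proof.
elim: p F => //= p IHp F Flin; split=> [s zs c u v|u].
  by rewrite (Flin [::]) ?zs // -mul_mpolyC.
by apply: IHp => s1 s2 c v w z; rewrite (Flin (u :: s1)) //= addSn z.
Qed.

Lemma polylin_at p (F : seq S -> S^o) s1 s2 c u v :
  polylin p F -> (size s1 + size s2).+1 = p ->
  F (s1 ++ (c *: u + v) :: s2) = c *: (F (s1 ++ u :: s2) : S) + F (s1 ++ v :: s2).
Proof.
elim: p s1 F => [|p IHp] [|x s1] F //= [F1 F2] [z].
  by rewrite F1 // -mul_mpolyC.
exact: (IHp s1 (fun s => F (x :: s)) (F2 x) z).
Qed.

Lemma component_polylin p (f : cochain n p) k : multilinear f -> polylin p (component f k).
Proof.
move=> fl; apply: polylin_of => s1 s2 c u v z.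
have ip : (size s1 < p)%N by rewrite -z ltnS leq_addr.
pose i0 := Ordinal ip; pose a0 (i : 'I_p) := nth 0 (s1 ++ 0 :: s2) i.
have E w : (fun i : 'I_p => nth 0 (s1 ++ w :: s2) i) = upd a0 i0 w.
  apply/funext => i; rewrite /upd /a0 !nth_cat -val_eqE /=.
  case: ltngtP => // [l|->]; last by rewrite subnn.
  by move: l; rewrite -subn_gt0; case: (i - _)%N.
by rewrite /component !E fl.
Qed.

Lemma args_upd p (a : 'I_p -> S) i u :
  args (upd a i u) = take i (args a) ++ u :: drop i.+1 (args a).
Proof.
have zt : size (take i (args a)) = i by rewrite size_takel // size_args ltnW.
apply: (@eq_from_nth _ 0) => [|j]; rewrite size_args.
  rewrite size_cat /= zt size_drop size_args; have := ltn_ord i; lia.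
move=> jp; rewrite -[j]/(val (Ordinal jp)) nth_args /upd -val_eqE /= nth_cat zt.
case: ltngtP => [l|l|->]; last by rewrite subnn.
  by rewrite nth_take // -[j]/(val (Ordinal jp)) nth_args.
case E: (j - i)%N => [|m]; first by move: l; rewrite -subn_gt0 E.
rewrite /= nth_drop (_ : (i.+1 + m)%N = Ordinal jp) ?nth_args //=; lia.
Qed.

Lemma size_take_drop p (a : 'I_p -> S) (i : 'I_p) :
  (size (take i (args a)) + size (drop i.+1 (args a))).+1 = p.
Proof.
rewrite size_takel ?size_drop size_args; last exact: ltnW.
have := ltn_ord i; lia.
Qed.

Lemma eq_twdiff gamma (F F' : seq S -> S^o) s :
  (forall u, (size u).+1 = size s -> F u = F' u) ->
  twdiff gamma F s = twdiff gamma F' s.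
Proof. by move=> FF'; rewrite /twdiff (@eq_bdiff_sized _ _ _ _ _ F F'). Qed.

Lemma twdiff0 gamma (F : seq S -> S^o) s :
  (forall u, (size u).+1 = size s -> F u = 0) -> twdiff gamma F s = 0.
Proof.
move=> F0; rewrite /twdiff (@eq_bdiff_sized _ _ _ _ _ F (fun u => F u - F u)).
  by rewrite bdiffB subrr.
by move=> u zu; rewrite F0 // subrr.
Qed.

End ListCochains.

(** * Splitting over the group, and generation in degrees 0 and 1 *)

Section SkewCochains.
Variables (n : nat) (G : seq (mat n)).
Hypotheses (Guniq : uniq G) (G1 : 1%:M \in G).
Hypothesis GM : forall g h, g \in G -> h \in G -> g *m h \in G.
Local Notation S := (SV n).

Let act0 (g : mat n) : act g 0 = 0. Proof. exact: rmorph0. Qed.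

Lemma big_uniq1 (f : mat n -> S) g :
  g \in G -> (forall h, h != g -> f h = 0) -> \sum_(h <- G) f h = f g.
Proof. by move=> gG f0; rewrite (bigD1_seq g) //= big1 ?addr0. Qed.

Lemma skew_mul_out (x y : Defs.skew n) k : k \notin G -> skew_mul G x y k = 0.
Proof.
move=> kG; rewrite /skew_mul big_seq big1 // => g gG.
rewrite big_seq_cond big1 // => h /andP[hG /eqP E].
by case/negP: kG; rewrite -E GM.
Qed.

Lemma skew_mul_conc (x y : Defs.skew n) (g g' : mat n) (a b : S) k :
  g \in G -> g' \in G ->
  (forall h, x h = if h == g then a else 0) ->
  (forall h, y h = if h == g' then b else 0) ->
  skew_mul G x y k = if k == g *m g' then a * act g b else 0.
Proof.
move=> gG g'G Ex Ey; rewrite /skew_mul (big_uniq1 gG) => [|h /negbTE hg].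
  rewrite big_mkcond (big_uniq1 g'G) => [|h /negbTE hg].
    by rewrite Ex Ey !eqxx eq_sym.
  by rewrite Ey hg act0 mulr0 if_same.
by rewrite big1 // => h' _; rewrite Ex hg mul0r.
Qed.

Lemma skew_mul_embedl b (y : Defs.skew n) k :
  k \in G -> skew_mul G (embed b) y k = b * y k.
Proof.
move=> kG; rewrite /skew_mul (big_uniq1 G1) => [|h /negbTE h1].
  rewrite big_mkcond (big_uniq1 kG) => [|h /negbTE hk]; last by rewrite mul1mx hk.
  by rewrite mul1mx eqxx /embed eqxx act1.
by rewrite big1 // => h' _; rewrite /embed h1 mul0r.
Qed.

Lemma skew_mul_embedr (x : Defs.skew n) b k :
  k \in G -> skew_mul G x (embed b) k = x k * act k b.
Proof.
move=> kG; rewrite /skew_mul.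
rewrite (eq_bigr (fun g => if g == k then x g * act g b else 0)) => [|g _].
  by rewrite (big_uniq1 kG) ?eqxx // => h /negbTE ->.
rewrite big_mkcond (big_uniq1 G1) => [|h /negbTE h1].
  by rewrite mulmx1 /embed eqxx.
by rewrite /embed h1 act0 mulr0 if_same.
Qed.

Lemma hdiff_out p (f : cochain n p) a k :
  supported G f -> k \notin G -> hdiff G f a k = 0.
Proof.
move=> fG kG; rewrite /hdiff !skew_mul_out // scaler0 addr0 add0r big1 // => i _.
by rewrite fG // scaler0.
Qed.

(** Left multiplication by a polynomial acts alike on all components, while on the right the
    polynomial must pass [k] and gets twisted by it. *)
Lemma hdiff_component p (f : cochain n p) a k :
  k \in G -> hdiff G f a k = twdiff (act k) (component f k) (args a).
Proof.
move=> kG; rewrite /hdiff skew_mul_embedl // skew_mul_embedr //.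
rewrite args_cons /twdiff /bdiff bmul_args component_args opprD addrA -sumrN.
congr (_ + _ + _).
- by rewrite component_args.
- apply: eq_bigr => i _; rewrite component_args.
  by rewrite exprS mulN1r scaleNr.
by rewrite exprS mulN1r scaleNr mulrC.
Qed.

Definition concentrated p (f : cochain n p) (g : mat n) (X : seq S -> S) : Prop :=
  forall a k, f a k = if k == g then X (args a) else 0.

Definition cochain_at p (g : mat n) (X : seq S -> S) : cochain n p :=
  fun a k => if k == g then X (args a) else 0.

Lemma cochain_at_cocycle p g (X : seq S -> S^o) :
  g \in G -> polylin p X ->
  (forall s, size s = p.+1 -> twdiff (act g) X s = 0) ->
  cocycle G (@cochain_at p g X).
Proof.
move=> gG Xp cX.
have supp : supported G (@cochain_at p g X).
  by move=> a k kG; rewrite /cochain_at; case: eqP kG => // ->; rewrite gG.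
split=> // [a i c u v k|a k].
  rewrite /cochain_at; case: eqP => _; last by rewrite scaler0 addr0.
  by rewrite !args_upd (polylin_at _ _ _ Xp) // size_take_drop.
case: (boolP (k \in G)) => kG; last exact: hdiff_out.
rewrite hdiff_component //; have [->|/negbTE kg] := eqVneq k g; last first.
  by apply: twdiff0 => u _; rewrite /component /cochain_at kg.
apply: etrans (cX (args a) (size_args a)); apply: eq_twdiff => u.
by rewrite size_args => -[zu]; rewrite /component /cochain_at eqxx args_nth.
Qed.

(** The empty product is the unit in degree 0. Each further factor is a 1-cocycle concentrated at
    its own twist, and concentrated cochains multiply like group elements. *)
Lemma gen01_cupder (E : seq ((S -> S) * mat n)) :
  twders E -> all (fun q => q.2 \in G) E ->
  mxprod E \in G /\
  exists f : cochain n (size E), gen01 G f /\ concentrated f (mxprod E) (cupder E).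
Proof.
elim: E => [|q E IHE].
  move=> _ _; split=> //; exists (@cochain_at 0 1%:M (cupder [::])); split=> //.
  apply: gen01_deg0; apply: cochain_at_cocycle => // s zs.
  by apply: (@cupder_cocycle n [::]).
move=> dqE /= /andP[qG EG]; have [dq dE] := twders_cons dqE.
have [pG [f [fgen fE]]] := IHE dE EG; split; first exact: GM.
have d1 : twders [:: q].
  by move=> i; rewrite ltnS leqn0 => /eqP ->.
have q1 : mxprod [:: q] = q.2 by rewrite /mxprod /= mulmx1.
have c1 : cocycle G (@cochain_at 1 q.2 (cupder [:: q])).
  apply: cochain_at_cocycle => //; first exact: (cupder_polylin d1).
  by move=> s zs; rewrite -[in act _]q1; apply: cupder_cocycle.
exists (cup G (@cochain_at 1 q.2 (cupder [:: q])) f); split.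
  exact: (@gen01_cup n G 1 (size E) _ _ (gen01_deg1 c1) fgen).
move=> a k; rewrite /cup.
rewrite (skew_mul_conc (g := q.2) (g' := mxprod E)
  (a := cupder [:: q] (args (fun i => a (@lshift 1 (size E) i))))
  (b := cupder E (args (fun j => a (rshift 1 j))))) //.
case: eqP => // _; rewrite (args_cons a).
have -> : args (fun i => a (@lshift 1 (size E) i)) = [:: a ord0].
  by rewrite args_cons args0; congr [:: a _]; exact: val_inj.
have -> : args (fun j => a (rshift 1 j)) = args (fun j => a (lift ord0 j)).
  by congr (args _); apply/funext => i; congr a; exact: val_inj.
transitivity (q.1 (a ord0) * act q.2 1 * act q.2 (cupder E (args (fun j => a (lift ord0 j))))).
  by [].
by rewrite rmorph1 mulr1.
Qed.

(** A polynomial at the identity is a 0-cocycle because [S] is commutative, and the cup product with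
    it is multiplication. *)
Lemma gen01_scaled (b : S) (E : seq ((S -> S) * mat n)) :
  twders E -> all (fun q => q.2 \in G) E ->
  exists f : cochain n (size E),
    gen01 G f /\ concentrated f (mxprod E) (fun s => b * cupder E s).
Proof.
move=> dE EG; have [pG [f [fgen fE]]] := gen01_cupder dE EG.
have c0 : cocycle G (@cochain_at 0 1%:M (fun=> b)).
  apply: cochain_at_cocycle => // -[|x [|y s]] // _.
  by rewrite /twdiff /= act1; exact: subrr.
exists (cup G (@cochain_at 0 1%:M (fun=> b)) f); split.
  exact: (@gen01_cup n G 0 (size E) _ _ (gen01_deg0 c0) fgen).
move=> a k; rewrite /cup.
rewrite (skew_mul_conc (g := 1%:M) (g' := mxprod E) (a := b)
  (b := cupder E (args (fun j => a (rshift 0 j))))) // mul1mx act1.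
case: eqP => // _; congr (b * cupder E (args _)).
by apply/funext => i; congr a; exact: val_inj.
Qed.

(** [gen01] has no rule for zero, so some generated cochain of degree [p] is multiplied by 0. *)
Lemma gen01_zero p : exists f : cochain n p, gen01 G f /\ forall a k, f a k = 0.
Proof.
pose E := nseq p ((fun=> 0 : S) : S -> S, 1%:M : mat n).
have zE : size E = p by rewrite size_nseq.
have dE : twders E.
  move=> i iE; rewrite nth_nseq if_same; split=> [c a b|a b] /=.
    by rewrite scaler0 addr0.
  by rewrite mulr0 mul0r addr0.
have EG : all (fun q => q.2 \in G) E by apply/allP => q /nseqP[-> _].
have [_] := gen01_cupder dE EG; rewrite zE => -[f [fgen _]].
exists (fun a k => 0 *: f a k); split=> [|a k]; last exact: scale0r.
exact: gen01_scale.
Qed.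

Lemma gen01_sum p (I : eqType) (r : seq I) (k : mat n) (X : I -> seq S -> S) :
  (forall J, J \in r ->
     exists f : cochain n p, gen01 G f /\ concentrated f k (X J)) ->
  exists f : cochain n p,
    gen01 G f /\ concentrated f k (fun s => \sum_(J <- r) X J s).
Proof.
elim: r => [_|J r IHr Xr].
  have [f [fgen f0]] := gen01_zero p; exists f; split=> // a k'.
  by rewrite f0 big_nil if_same.
have [|f [fgen fX]] := IHr; first by move=> J' J'r; apply: Xr; rewrite inE J'r orbT.
have [g [ggen gX]] := Xr J (mem_head _ _).
exists (fun a k' => g a k' + f a k'); split; first exact: gen01_add.
move=> a k'; rewrite fX gX big_cons; case: eqP => // _; exact: addr0.
Qed.

Hypothesis Gcodim : forall g, g \in G -> prod_refl G g (codim_fixed g).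

Lemma gen01_component p (f : cochain n p.+1) k : cocycle G f -> k \in G ->
  exists (h : cochain n p.+1) (w : seq S -> S^o),
    [/\ gen01 G h, forall a k', k' != k -> h a k' = 0, polylin p w
      & forall a, f a k - h a k = twdiff (act k) w (args a)].
Proof.
move=> [fl fG fc] kG; have [s [zs sG Ek]] := Gcodim kG.
have refl_s r : r \in s -> is_reflection r by case/sG.
have cf u : size u = p.+2 -> twdiff (act k) (component f k) u = 0.
  by move=> zu; rewrite -(args_nth zu) -hdiff_component.
have [r [coef [E [EP [w wp Ew]]]]] :=
  cocycle_decomposition refl_s Ek zs (component_polylin k fl) cf.
have [h [hgen hX]] : exists h : cochain n p.+1, gen01 G h
    /\ concentrated h k (fun u => \sum_(J <- r) coef J * cupder (E J) u).
  apply: gen01_sum => J /EP[dE zE pE EG].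
  rewrite -zE -pE; apply: gen01_scaled => //.
  apply: sub_all EG => q; rewrite inE => /orP[/eqP -> // | /sG[] //].
exists h, w; split=> // [a k' /negbTE kk'|a]; first by rewrite hX kk'.
rewrite -(component_args f) Ew ?size_args // hX eqxx.
by rewrite addrAC [X in X + _]subrr; exact: add0r.
Qed.

(** The cochains found for different [k] live in different components, so adding them up disturbs
    none of the corrections. *)
Lemma gen01_components p (f : cochain n p.+1) (r : seq (mat n)) :
  cocycle G f -> {subset r <= G} ->
  exists (h : cochain n p.+1) (W : mat n -> seq S -> S^o),
    [/\ gen01 G h, forall a k, k \notin r -> h a k = 0
      & forall k, k \in r -> polylin p (W k)
          /\ forall a, f a k - h a k = twdiff (act k) (W k) (args a)].
Proof.
move=> fc; elim: r => [_|k r IHr rG].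
  have [h [hgen h0]] := gen01_zero p.+1.
  by exists h, (fun _ _ => 0); split.
have [|h [W [hgen h0 hW]]] := IHr; first by move=> g gr; apply: rG; rewrite inE gr orbT.
case: (boolP (k \in r)) => kr.
  exists h, W; split=> // [a g|g]; last by rewrite inE => /orP[/eqP ->|]; exact: hW.
  by rewrite inE negb_or => /andP[_]; exact: h0.
have [g [w [ggen g0 wp Ew]]] := gen01_component fc (rG k (mem_head _ _)).
exists (fun a k' => g a k' + h a k'), (fun k' => if k' == k then w else W k').
split=> [|a k'|k'].
- exact: gen01_add.
- by rewrite inE negb_or => /andP[kk' k'r]; rewrite g0 // h0 // addr0.
rewrite inE; case: eqVneq => [-> _|kk' /= k'r].
  by split=> // a; rewrite h0 // addr0 Ew.
have [Wp EW] := hW k' k'r; split=> // a.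
by rewrite g0 // add0r EW.
Qed.

Lemma coboundary_of_components p (f : cochain n p.+1) (W : mat n -> seq S -> S^o) :
  supported G f ->
  (forall k, k \in G -> polylin p (W k)
     /\ forall a, f a k = twdiff (act k) (W k) (args a)) ->
  coboundary G f.
Proof.
move=> fG fW; exists (fun a k => if k \in G then W k (args a) else 0).
have supp : supported G (fun (a : 'I_p -> S) k => if k \in G then W k (args a) else 0).
  by move=> a k /negbTE ->.
split=> // [a i c u v k|a k].
  case: ifP => kG; last by rewrite scaler0 addr0.
  have [Wp _] := fW k kG.
  by rewrite !args_upd (polylin_at _ _ _ Wp) // size_take_drop.
case: (boolP (k \in G)) => kG; last by rewrite hdiff_out ?fG.
have [_ ->] := fW k kG; rewrite hdiff_component //; apply: eq_twdiff => u.
by rewrite size_args => -[zu]; rewrite /component kG args_nth.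
Qed.

End SkewCochains.

Theorem theorem10p3 (n : nat) (G : seq (mat n)) :
  finite_reflection_group G ->
  (forall g, g \in G -> refl_length G g (codim_fixed g)) ->
  forall (p : nat) (f : cochain n p), cocycle G f ->
    exists h : cochain n p,
      gen01 G h /\ coboundary G (fun a k => f a k - h a k).
Proof.
move=> [Guniq G1 _ GM _] Gl [|p] f fc.
  by exists f; split; [exact: gen01_deg0 | move=> a k; rewrite subrr].
have Gcodim g : g \in G -> prod_refl G g (codim_fixed g) by move=> /Gl[].
have [h [W [hgen h0 hW]]] := gen01_components Guniq G1 GM Gcodim fc (fun _ => id).
exists h; split=> //; apply: (coboundary_of_components Guniq G1 GM (W := W)) => //.
by move=> a k kG; have [_ fG _] := fc; rewrite fG // h0 // subrr.
Qed.
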